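(* Let $p\in(1,\infty)$ and let $w\in A_p(\Omega)$ be a weight. Then for every $r\in(1,\infty)$ there is $C>0$ such that for every sequence $(f_j)_{j\in\mathbb N}$ of measurable functions, $$\Big\|\Big\{\sum_{j\in\mathbb N}[M(f_j)]^r\Big\}^{1/r}\Big\|_{L^p(\Omega,w\,d\mathbb P)}\le C\Big\|\Big(\sum_{j\in\mathbb N}|f_j|^r\Big)^{1/r}\Big\|_{L^p(\Omega,w\,d\mathbb P)}.$$
   Context: Let $(\Omega,\mathcal F,\mathbb P)$ be a probability space, $(\mathcal F_n)_{n\in\mathbb Z_+}$ a nondecreasing sequence of sub-$\sigma$-algebras of $\mathcal F$, $\mathbb E_n$ the conditional expectation w.r.t. $\mathcal F_n$, and $M(f):=\sup_{n\in\mathbb Z_+}|\mathbb E_n f|$ the Doob maximal operator. A weight is a strictly positive integrable function $w$ on $\Omega$; $\|f\|_{L^p(\Omega,w\,d\mathbb P)}:=(\int_\Omega|f|^pw\,d\mathbb P)^{1/p}$. For $p\in(1,\infty)$, $w\in A_p(\Omega)$ if there is $K>0$ with $\mathbb E_n(w)[\mathbb E_n(w^{-1/(p-1)})]^{p-1}\le K$ a.e. for all $n\in\mathbb Z_+$. *)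

(* Defs.v *)
From HB Require Import structures.
From mathcomp Require Import all_boot all_order all_algebra.
From mathcomp Require Import all_classical all_reals all_analysis measurable_realfun.
Set Implicit Arguments. Unset Strict Implicit. Unset Printing Implicit Defensive.
Import Order.TTheory GRing.Theory Num.Theory.
Local Open Scope classical_set_scope.
Local Open Scope ring_scope.

Section Defs.
Context {d : measure_display} {T : measurableType d} {R : realType}.

Definition measurable_wrt (G : set (set T)) (g : T -> R) : Prop :=
  forall B : set R, measurable B -> G (g @^-1` B).

Definition emeasurable_wrt (G : set (set T)) (g : T -> \bar R) : Prop :=
  forall B : set (\bar R), measurable B -> G (g @^-1` B).

Definition filtration (F : nat -> set (set T)) : Prop :=
  (forall n, sigma_algebra setT (F n)) /\
  (forall n, F n `<=` measurable) /\
  (forall n m, (n <= m)%N -> F n `<=` F m).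

Definition cond_exp_nneg (P : probability T R) (G : set (set T))
    (f : T -> R) (h : T -> \bar R) : Prop :=
  emeasurable_wrt G h /\ (forall x, (0 <= h x)%E) /\
  forall A, G A -> (\int[P]_(x in A) h x = \int[P]_(x in A) (f x)%:E)%E.

(* g is a version of the (generalized) conditional expectation E[f | G]:
   g is G-measurable and, on every G-set A on which f is integrable,
   g is integrable and has the same integral as f.  For f integrable (or,
   more generally, G-locally integrable) this is the usual conditional
   expectation, unique a.e. *)
Definition cond_exp (P : probability T R) (G : set (set T))
    (f : T -> R) (g : T -> R) : Prop :=
  measurable_wrt G g /\
  forall A, G A -> P.-integrable A (EFin \o f) ->
    P.-integrable A (EFin \o g) /\
    (\int[P]_(x in A) (g x)%:E = \int[P]_(x in A) (f x)%:E)%E.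

Definition weight (P : probability T R) (w : T -> R) : Prop :=
  (forall x, 0 < w x) /\ measurable_fun setT w /\ P.-integrable setT (EFin \o w).

Definition Ap_weight (P : probability T R) (F : nat -> set (set T))
    (p : R) (w : T -> R) : Prop :=
  exists K : R, 0 < K /\
    forall n, exists a b : T -> \bar R,
      cond_exp_nneg P (F n) w a /\
      cond_exp_nneg P (F n) (fun x => w x `^ (- (p - 1)^-1)) b /\
      {ae P, forall x, (a x * (b x `^ (p - 1)) <= K%:E)%E}.

(* Doob maximal function M(f) = sup_n |E_n f|, given versions g n of E_n f *)
Definition doob_max (g : nat -> T -> R) (x : T) : \bar R :=
  ereal_sup (range (fun n => (`|g n x|)%:E)).

Definition wLpnorm (P : probability T R) (w : T -> R) (p : R)
    (h : T -> \bar R) : \bar R :=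
  ((\int[P]_x (h x `^ p * (w x)%:E)) `^ p^-1)%E.

Definition lr_sum (r : R) (u : nat -> T -> \bar R) (x : T) : \bar R :=
  ((\sum_(0 <= j <oo) (u j x `^ r)) `^ r^-1)%E.

End Defs.

(* Main.v *)
Require Import Defs.
From HB Require Import structures.
From mathcomp Require Import all_boot all_order all_algebra.
From mathcomp Require Import all_classical all_reals all_analysis measurable_realfun.
From mathcomp Require Import ring lra.
Set Implicit Arguments. Unset Strict Implicit. Unset Printing Implicit Defensive.
Import Order.TTheory GRing.Theory Num.Theory.
Import numFieldNormedType.Exports.
Local Open Scope classical_set_scope.
Local Open Scope ring_scope.

(* Everything is reduced to nonnegative functions, a finite horizon [n < N] and
   finitely many [f_j]; monotone convergence recovers the theorem at the end.

   Scalar case (p = r).  With s = w^(-1/(p-1)) and the weighted expectations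
   E_n^s h = E_n(h s) / E_n s, the A_p condition gives
     (E_n f)^(p-1) <= K E_n^w (M_s(f/s)^(p-1) / w),
   so two applications of Doob's inequality, for the measures s dP and w dP,
   bound M on L^p(w) with a constant depending only on p and K.

   General case, by extrapolation.  The Rubio de Francia series turns h into a
   majorant H of comparable norm with E_n H <= C H.  If p <= r, take h to be the
   right-hand side square function; then w H^(p-r) is an A_r weight.  If r < p,
   take h = g^(p-1) w in L^p'(s), where g is the left-hand side; then
   w^((r-1)/(p-1)) H^((p-r)/(p-1)) is an A_r weight.  In both cases the scalar
   inequality in L^r for the new weight gives the claim.

   Since s need not be integrable, w is first multiplied by an F_0-measurable
   function m such that m w and (m w)^(-1/(p-1)) are both integrable; this
   commutes with every E_n and leaves the A_p constant unchanged. *)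

(** * Conditioning on a sub-sigma-algebra *)

(** Extrapolation works because E_n H <= C H makes the powers of H cancel in the A_r condition: a
    positive power of exponent at most 1 has conditional expectation controlled by that power of E_n
    H, and a negative power of H is bounded pointwise by the same power of E_n H. Wherever Hölder's
    inequality would be expected, the pointwise bound x^t y^(1-t) <= x + y is integrated instead;
    this costs only numerical factors. All constants are uniform in the horizon and in the number of
    functions. Two obstacles shape the proof. Absorption into the left-hand side needs that side to
    be finite beforehand, which explains the truncation in Doob's inequality and, when r < p, a
    separate qualitative bound for finitely many functions. Negative powers of H need H away from 0,
    so a small constant is added to h and sent to 0 at the end. *)

Section SubSigmaAlgebra.
Context {d : measure_display} {T : measurableType d} {R : realType}.
Variables (mu : {finite_measure set T -> \bar R}) (G : set (set T)).
Hypotheses (sG : sigma_algebra setT G) (GT : G `<=` measurable).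

Notation TG := (g_sigma_algebraType G).

Lemma measurableG (A : set T) : @measurable _ TG A = G A.
Proof. by rewrite /measurable/= sigma_algebra_id. Qed.

Lemma measurable_wrtE (g : T -> R) :
  measurable_wrt G g <-> @measurable_fun _ _ TG R setT g.
Proof.
split=> [mg _ B mB|mg B mB]; first by rewrite setTI measurableG; exact: mg.
by have := mg (@measurableT _ TG) B mB; rewrite setTI measurableG.
Qed.

Lemma measurable_id_sub : @measurable_fun _ _ T TG setT id.
Proof. by move=> _ B; rewrite measurableG setTI preimage_id => /GT. Qed.

Lemma measurable_sub d' (U : measurableType d') (g : T -> U) :
  @measurable_fun _ _ TG U setT g -> measurable_fun setT g.
Proof. by move=> mg; exact: (measurableT_comp mg measurable_id_sub). Qed.

Import HBNNSimple.

(** Comparison on the sets of G extends to G-measurable simple factors by summing over their level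
    sets, and then to [c] by monotone convergence. *)
Lemma le_integral_mul_sub (u v : T -> \bar R) (c : T -> R) :
  measurable_fun setT u -> measurable_fun setT v ->
  (forall x, (0 <= u x)%E) -> (forall x, (0 <= v x)%E) ->
  (forall x, 0 <= c x) -> @measurable_fun _ _ TG R setT c ->
  (forall A, G A -> \int[mu]_(x in A) u x <= \int[mu]_(x in A) v x)%E ->
  (\int[mu]_x ((c x)%:E * u x) <= \int[mu]_x ((c x)%:E * v x))%E.
Proof.
move=> mu_ mv u0 v0 c0 mc uv.
have mc' : @measurable_fun _ _ TG _ setT (EFin \o c) by exact/measurable_EFinP.
pose s := nnsfun_approx (@measurableT _ TG) mc'.
have ms n : measurable_fun setT (s n : T -> R) by exact: measurable_sub (measurable_funP (s n)).
have nds x m n : (m <= n)%N -> s m x <= s n x.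
  by move=> mn; have /lefP/(_ x) := nd_nnsfun_approx (@measurableT _ TG) mc' mn.
have lims u' : measurable_fun setT u' -> (forall x, (0 <= u' x)%E) ->
   (\int[mu]_x ((c x)%:E * u' x) = limn (fun n => \int[mu]_x ((s n x)%:E * u' x)))%E.
  move=> mu' u'0; rewrite -monotone_convergence//=.
  - apply: eq_integral => x _; apply/esym/cvg_lim => //.
    have c0' y : setT y -> (0 <= (EFin \o c) y)%E by rewrite /= lee_fin.
    have sc := cvg_nnsfun_approx (@measurableT _ TG) mc' c0' (x := x) I.
    (* The product 0 * oo is the delicate case for the limit. Where [c x] is 0 every [s n x] is 0 as
       well, since [s n] stays below [c]. *)
    have [cx0|cx0] := eqVneq (c x) 0.
      have s0 n : s n x = 0.
        apply/eqP; rewrite eq_le fun_ge0 andbT -lee_fin.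
        have := @le_approx _ TG R setT (EFin \o c) n x c0' I.
        by rewrite -nnsfun_approxE /= cx0.
      by rewrite cx0 mul0e; under eq_fun do rewrite s0 mul0e; exact: cvg_cst.
    apply: cvgeM; [|exact: sc|exact: cvg_cst].
    have [uf|un] := boolP (u' x \is a fin_num); first exact: mule_def_fin.
    by apply: mule_def_neq0_infty => //; rewrite eqe.
  - by move=> n; apply: emeasurable_funM => //; exact/measurable_EFinP.
  - by move=> n x _; rewrite mule_ge0// lee_fin.
  - move=> x _ m n mn; rewrite lee_wpmul2r// lee_fin.
    exact: nds.
have step n : (\int[mu]_x ((s n x)%:E * u x) <= \int[mu]_x ((s n x)%:E * v x))%E.
  have E u' : measurable_fun setT u' -> (forall x, (0 <= u' x)%E) ->
    (\int[mu]_x ((s n x)%:E * u' x) =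
      \sum_(k \in range (s n)) (`|k|%:E * \int[mu]_(x in s n @^-1` [set k]) u' x))%E.
    move=> mu' u'0.
    have mA k : measurable (s n @^-1` [set k] : set T).
      by apply: GT; rewrite -measurableG; exact: measurable_funPTI.
    transitivity (\int[mu]_x (\sum_(k \in range (s n))
       (`|k|%:E * (u' x * (\1_(s n @^-1` [set k] : set T) x)%:E))))%E.
      apply: eq_integral => x _; rewrite fimfunE -fsumEFin// ge0_mule_fsuml; last first.
        by move=> r; rewrite EFinM nnfun_muleindic_ge0.
      apply: eq_fsbigr => r /set_mem[t _ <-].
      by rewrite ger0_norm// EFinM -muleA (muleC (u' x)).
    rewrite ge0_integral_fsum//; last 2 first.
    - move=> k; apply: measurable_funeM; apply: emeasurable_funM => //.
      by apply/measurable_EFinP; exact: measurable_indic.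
    - by move=> k x _; rewrite mule_ge0// mule_ge0// lee_fin.
    apply: eq_fsbigr => k _; rewrite ge0_integralZl//; last 2 first.
    - by apply: emeasurable_funM => //; apply/measurable_EFinP; exact: measurable_indic.
    - by move=> x _; rewrite mule_ge0// lee_fin.
    by congr (_ * _)%E; rewrite [RHS]integral_mkcond epatch_indic.
  rewrite !E//; apply: lee_fsum => // k kr; rewrite lee_wpmul2l//.
  apply: uv; rewrite -measurableG; exact: measurable_funPTI.
rewrite !lims//; apply: lee_lim.
- apply: ereal_nondecreasing_is_cvgn => m n mn; apply: ge0_le_integral => //.
  + by move=> x _; rewrite mule_ge0// lee_fin.
  + by apply: emeasurable_funM => //; exact/measurable_EFinP.
  + by apply: emeasurable_funM => //; exact/measurable_EFinP.
  + move=> x _; rewrite lee_wpmul2r// lee_fin; exact: nds.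
- apply: ereal_nondecreasing_is_cvgn => m n mn; apply: ge0_le_integral => //.
  + by move=> x _; rewrite mule_ge0// lee_fin.
  + by apply: emeasurable_funM => //; exact/measurable_EFinP.
  + by apply: emeasurable_funM => //; exact/measurable_EFinP.
  + move=> x _; rewrite lee_wpmul2r// lee_fin; exact: nds.
- by apply: nearW => n; exact: step.
Qed.

(** The function is the Radon-Nikodym derivative, on the measurable space generated by G, of f dmu
    with respect to the restriction of mu. *)
Lemma exists_cond_exp (f : T -> R) :
  measurable_fun setT f -> (forall x, 0 <= f x) ->
  (\int[mu]_x (f x)%:E < +oo)%E ->
  exists e : T -> R, [/\ forall x, 0 <= e x, @measurable_fun _ _ TG R setT e &
    forall A, G A -> (\int[mu]_(x in A) (e x)%:E = \int[mu]_(x in A) (f x)%:E)%E].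
Proof.
move=> mf f0 fi.
have mfE (A : set T) : measurable_fun A (EFin \o f).
  by apply/measurable_EFinP; exact: measurable_funTS.
pose nu0 (A : set TG) : \bar R := (\int[mu]_(x in (A : set T)) (f x)%:E)%E.
have nu00 : nu0 set0 = 0%E by rewrite /nu0 integral_set0.
have nu0_ge0 A : (0 <= nu0 A)%E by apply: integral_ge0 => x _; rewrite lee_fin.
have nu0_sigma : semi_sigma_additive nu0.
  move=> H mH tH mUH; rewrite /nu0 ge0_integral_bigcup//=.
  - apply: is_cvg_ereal_nneg_natsum => n _; exact: nu0_ge0.
  - by move=> n; apply: GT; rewrite -measurableG; exact: mH.
  - by move=> x _; rewrite lee_fin.
have nu0_fin : fin_num_fun nu0.
  move=> A mA; rewrite ge0_fin_numE//; apply: le_lt_trans fi.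
  apply: ge0_subset_integral => //; first by apply: GT; rewrite -measurableG.
  by move=> x _; rewrite lee_fin.
pose nu1 : {measure set TG -> \bar R} :=
  HB.pack nu0 (isMeasure.Build _ _ _ nu0 nu00 nu0_ge0 nu0_sigma).
pose nu : {finite_measure set TG -> \bar R} :=
  HB.pack nu0 (isMeasure.Build _ _ _ nu0 nu00 nu0_ge0 nu0_sigma)
    (Measure_isFinite.Build _ _ _ nu1 nu0_fin).
pose m0 : set TG -> \bar R := mu.
have mT A : @measurable _ TG A -> measurable (A : set T) by rewrite measurableG => /GT.
have m0_sigma : semi_sigma_additive m0.
  move=> H mH tH mUH; apply: measure_semi_sigma_additive => //; last exact: mT.
  by move=> n; exact: mT.
have m0_fin : fin_num_fun m0 by move=> A /mT mA; exact: fin_num_measure.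
pose m1 : {measure set TG -> \bar R} :=
  HB.pack m0 (isMeasure.Build _ _ _ m0 (measure0 mu) (fun A => measure_ge0 mu A) m0_sigma).
pose m : {finite_measure set TG -> \bar R} :=
  HB.pack m0 (isMeasure.Build _ _ _ m0 (measure0 mu) (fun A => measure_ge0 mu A) m0_sigma)
    (Measure_isFinite.Build _ _ _ m1 m0_fin).
have nm : nu `<< m.
  apply/null_content_dominatesP => A mA mA0; exact: null_set_integral (mT _ mA) _ mA0.
have [h [h0 hi hE]] := radon_nikodym_finite nm.
have mh : @measurable_fun _ _ TG _ setT h by case/integrableP : hi.
have mhT := measurable_sub mh.
have hE' A : G A -> (\int[mu]_(x in A) h x = \int[mu]_(x in A) (f x)%:E)%E.
  move=> GA; have mA : @measurable _ TG A by rewrite measurableG.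
  transitivity (nu A) => //; rewrite hE//.
  (* The restriction of [mu] is its pushforward under the identity from T to [TG], which brings the
     integral back to T. *)
  transitivity (\int[pushforward mu (id : T -> TG)]_(x in (A : set TG)) h x)%E => //.
  rewrite (ge0_integral_pushforward measurable_id_sub)//.
  exact: measurable_funTS.
(* [h] is integrable, so replacing its infinite values by 0 changes it on a null set only. *)
have hfin : ae_eq mu setT h (EFin \o fine \o h).
  have : mu.-integrable setT h.
    apply/integrableP; split; first exact: mhT.
    under eq_integral do rewrite gee0_abs//.
    by rewrite hE'//; case: sG => G0 /(_ _ G0); rewrite setD0.
  move=> hint; have := integrable_ae measurableT hint.
  by apply: filterS => x /(_ I) hx _ /=; rewrite fineK.
exists (fine \o h); split.
- by move=> x; rewrite fine_ge0.
- by apply: (measurableT_comp (fine_measurable measurableT)).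
- move=> A GA; rewrite -hE'//; apply: ge0_ae_eq_integral => //.
  + exact: GT.
  + by apply/measurable_EFinP/measurable_funTS; apply: (measurableT_comp (fine_measurable measurableT)).
  + exact: measurable_funTS.
  + by move=> x _; rewrite lee_fin fine_ge0.
  + by move: hfin; apply: filterS => x /(_ I) /= <-.
Qed.

End SubSigmaAlgebra.

(** * Inequalities for real powers and integrals *)

Section PowerInequalities.
Context {R : realType}.
Implicit Types x y a b p t : R.

(** Both factors are powers of numbers at most max(x, y), and the exponents add up to 1. *)
Lemma powR_mean_le x y t : 0 <= x -> 0 <= y -> 0 <= t <= 1 ->
  x `^ t * y `^ (1 - t) <= x + y.
Proof.
move=> x0 y0 /andP[t0 t1].
have m0 : 0 <= Num.max x y by rewrite le_max x0.
apply: (@le_trans _ _ (Num.max x y)); last first.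
  by rewrite ge_max lerDl lerDr x0 y0.
have <- : Num.max x y `^ t * Num.max x y `^ (1 - t) = Num.max x y.
  by rewrite -powRD ?subrKC ?powRr1// oner_eq0.
by apply: ler_pM; rewrite ?powR_ge0// ge0_ler_powR ?nnegrE ?subr_ge0// le_max lexx ?orbT.
Qed.

(** [powR_mean_le] for e^(-(1-t)/t) x and e y: the two scalings cancel in the product. *)
Lemma powR_mean_eps (t e : R) : 0 < t <= 1 -> 0 < e ->
  exists2 D, 0 < D & forall x y, 0 <= x -> 0 <= y ->
    x `^ t * y `^ (1 - t) <= D * x + e * y.
Proof.
move=> /andP[t0 t1] e0; exists (e `^ (- (1 - t) / t)); first exact: powR_gt0.
move=> x y x0 y0.
have := @powR_mean_le (e `^ (- (1 - t) / t) * x) (e * y) t.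
rewrite !mulr_ge0 ?powR_ge0 ?(ltW e0)// (ltW t0) t1 => /(_ isT isT isT); apply: le_trans.
rewrite !powRM ?powR_ge0 ?(ltW e0)// -powRrM mulfVK ?gt_eqF//.
rewrite mulrACA -powRD ?addNr ?powRr0 ?mul1r//.
by rewrite eqxx gt_eqF.
Qed.

(** A discrete form of d(a^p) = p/(p-1) a d(a^(p-1)). Expanded, it is Young's inequality for a
    b^(p-1) with exponents p and p/(p-1). *)
Lemma powR_increment a b p : 1 < p -> 0 <= b -> b <= a ->
  a `^ p - b `^ p <= p / (p - 1) * (a * (a `^ (p - 1) - b `^ (p - 1))).
Proof.
move=> p1 b0 ba; have a0 := le_trans b0 ba.
have p0 : 0 < p by lra.
have p10 : 0 < p - 1 by lra.
have := @conjugate_powR R a (b `^ (p - 1)) p (p / (p - 1)) a0 (powR_ge0 _ _) p0 (divr_gt0 p0 p10).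
have -> : p^-1 + (p / (p - 1))^-1 = 1 by field; rewrite !gt_eqF.
rewrite -powRrM (_ : (p - 1) * (p / (p - 1)) = p); last by field; rewrite gt_eqF.
move=> /(_ erefl) h.
rewrite mulrBr mulr_powRB1//.
have -> : a `^ p - b `^ p = p / (p - 1) * (a `^ p - (a `^ p / p + b `^ p / (p / (p - 1)))).
  by field; rewrite !gt_eqF.
rewrite ler_pM2l ?divr_gt0//; lra.
Qed.

End PowerInequalities.

(** Indices stay strictly below [N], so the running maximum of an adapted sequence up to [n.+1] is
    known at time n. *)
Fixpoint runmax {R : realType} (f : nat -> R) (N : nat) : R :=
  if N is n.+1 then Num.max (runmax f n) (f n) else 0.

Section RunMax.
Context {R : realType}.
Implicit Types f g : nat -> R.

Lemma runmax_ge0 f N : 0 <= runmax f N.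
Proof. by elim: N => //= N IH; rewrite le_max IH. Qed.

Lemma le_runmax f N n : (n < N)%N -> f n <= runmax f N.
Proof.
elim: N => //= N IH; rewrite ltnS leq_eqVlt => /predU1P[->|/IH fn].
  by rewrite le_max lexx orbT.
by rewrite le_max fn.
Qed.

Lemma runmax_le f N B : 0 <= B -> (forall n, (n < N)%N -> f n <= B) -> runmax f N <= B.
Proof.
move=> B0; elim: N => //= N IH fB; rewrite ge_max fB// IH// => n nN.
by apply: fB; exact: ltnW.
Qed.

Lemma runmax_nd f : {homo runmax f : m n / (m <= n)%N >-> m <= n}.
Proof.
by apply: homo_leq => [//|y x z|n] /=; [exact: le_trans|rewrite le_max lexx].
Qed.

Lemma runmax_homo f (h : R -> R) N : h 0 = 0 ->
  {homo h : x y / 0 <= x <= y >-> x <= y} -> (forall n, (n < N)%N -> 0 <= f n) ->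
  h (runmax f N) = runmax (h \o f) N.
Proof.
move=> h00 hh; elim: N => //= N IH f0; rewrite -IH => [|n nN]; last by apply: f0; exact: ltnW.
have fN := f0 _ (ltnSn N); have rN := runmax_ge0 f N.
have [rf|/ltW fr] := leP (runmax f N) (f N).
  by rewrite max_r// hh// rN.
by rewrite max_l// hh// fN.
Qed.

End RunMax.

(** * Measurability and integrals of nonnegative real functions *)

Section Measurability.
Context d (T : measurableType d) (R : realType).

Lemma measurable_powRf D (f : T -> R) p :
  measurable_fun D f -> measurable_fun D (fun x => f x `^ p).
Proof. by move=> mf; apply: (measurableT_comp (measurable_powR p) mf). Qed.

Lemma measurable_runmax D (f : nat -> T -> R) N :
  (forall n, (n < N)%N -> measurable_fun D (f n)) ->
  measurable_fun D (fun x => runmax (f ^~ x) N).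
Proof.
elim: N => [_|N IH mf]; first exact: measurable_cst.
by apply: measurable_maxr; [apply: IH => n nN; apply: mf; exact: ltnW|exact: mf].
Qed.

End Measurability.

(** Half of [A] can be moved to the left because [A] is finite; an infinite [B] makes the bound
    trivial. *)
Lemma absorb_half {R : realType} (A B : \bar R) (c : R) : 0 < c ->
  A \is a fin_num -> (0 <= B)%E ->
  (A <= c%:E * B + 2^-1%:E * A)%E -> (A <= (2 * c)%:E * B)%E.
Proof.
move=> c0; case: A => // a _; case: B => [b| |//] b0; last first.
  by move=> _; rewrite gt0_muley ?leey// lte_fin mulr_gt0.
rewrite -!EFinM -EFinD !lee_fin; lra.
Qed.

(** Recursion on the syntax of the function; the leaves are closed by hypotheses of the context,
    hence the many local measurability facts in the proofs. *)
Ltac mfun := intros; lazymatch goal with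
  | |- measurable_fun _ (fun _ => ?c) => exact: measurable_cst
  | |- measurable_fun _ (fun x => @GRing.add _ (@?f x) (@?g x)) =>
      apply: (measurable_funD (f := f) (g := g)); mfun
  | |- measurable_fun _ (fun x => @GRing.opp _ (@?f x)) =>
      apply: (measurable_funN (f := f)); mfun
  | |- measurable_fun _ (fun x => @GRing.mul _ (@?f x) (@?g x)) =>
      apply: (measurable_funM (f := f) (g := g)); mfun
  | |- measurable_fun _ (fun x => @powR _ (@?f x) _) =>
      apply: (measurable_powRf (f := f)); mfun
  | |- measurable_fun _ (fun x => \sum_(i <- _) _) => apply: measurable_sum; mfun
  | |- measurable_fun _ (fun x => runmax (fun n => @?f n x) _) =>
      apply: (measurable_runmax (f := f)); mfun
  | |- measurable_fun _ _ => solve [auto 2 with nocore]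
  end.

Ltac pos := intros; repeat first [ assumption | solve [done] | solve [apply: ltW; done] | exact: powR_ge0
  | exact: runmax_ge0 | apply: mulr_ge0 | apply: addr_ge0 | rewrite invr_ge0
  | (apply: sumr_ge0; intros) ].

Section NonnegIntegrals.
Context d (T : measurableType d) (R : realType) (mu : {measure set T -> \bar R}).
Implicit Types f g : T -> R.

Definition Int f : \bar R := (\int[mu]_x (f x)%:E)%E.

Lemma Int_ge0 f : (forall x, 0 <= f x) -> (0 <= Int f)%E.
Proof. by move=> f0; apply: integral_ge0 => x _; rewrite lee_fin. Qed.

Lemma Int_le f g : measurable_fun setT f -> measurable_fun setT g ->
  (forall x, 0 <= f x) -> (forall x, f x <= g x) -> (Int f <= Int g)%E.
Proof.
move=> mf mg f0 fg; apply: ge0_le_integral => //.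
- by move=> x _; rewrite lee_fin.
- exact/measurable_EFinP.
- exact/measurable_EFinP.
- by move=> x _; rewrite lee_fin.
Qed.

Lemma eq_Int f g : f =1 g -> Int f = Int g.
Proof. by move=> /funext ->. Qed.

Lemma IntD f g : measurable_fun setT f -> measurable_fun setT g ->
  (forall x, 0 <= f x) -> (forall x, 0 <= g x) ->
  (Int (fun x => f x + g x)%R = Int f + Int g)%E.
Proof.
move=> mf mg f0 g0; rewrite /Int; under eq_integral do rewrite EFinD.
by rewrite ge0_integralD//; try exact/measurable_EFinP; move=> x _; rewrite lee_fin.
Qed.

Lemma IntZ k f : measurable_fun setT f -> (forall x, 0 <= f x) -> 0 <= k ->
  (Int (fun x => k * f x)%R = k%:E * Int f)%E.
Proof.
move=> mf f0 k0; rewrite /Int; under eq_integral do rewrite EFinM.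
by rewrite ge0_integralZl//; [exact/measurable_EFinP|move=> x _; rewrite lee_fin].
Qed.

Lemma Int_sum (J : nat) (f : nat -> T -> R) :
  (forall j, measurable_fun setT (f j)) -> (forall j x, 0 <= f j x) ->
  (Int (fun x => \sum_(j < J) f j x)%R = \sum_(j < J) Int (f j))%E.
Proof.
move=> mf f0; elim: J => [|J IH].
  rewrite big_ord0 /Int; under eq_integral do rewrite big_ord0.
  by rewrite integral0.
rewrite big_ord_recr /= -IH -IntD//.
- by apply: eq_Int => x; rewrite big_ord_recr.
- exact: measurable_sum.
- by move=> x; exact: sumr_ge0.
Qed.

(** Monotone convergence without identifying the limit: each value of [g] need only be reached or
    exceeded at some index, as happens for truncations. *)
Lemma Int_sup (f : nat -> T -> R) g (B : \bar R) :
  (forall n, measurable_fun setT (f n)) -> (forall n x, 0 <= f n x) ->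
  (forall x, {homo f^~ x : m n / (m <= n)%N >-> m <= n}) ->
  (forall x, exists n, g x <= f n x) -> measurable_fun setT g -> (forall x, 0 <= g x) ->
  (forall n, (Int (f n) <= B)%E) -> (Int g <= B)%E.
Proof.
move=> mf f0 ndf gf mg g0 fB.
have lim_le : (limn (fun n => Int (f n)) <= B)%E.
  apply: lime_le; last exact: nearW.
  by apply: ereal_nondecreasing_is_cvgn => m n mn; apply: Int_le => // x; exact: ndf.
apply: le_trans lim_le; rewrite /Int -monotone_convergence//=.
- apply: ge0_le_integral => //.
  + by move=> x _; rewrite lee_fin.
  + exact/measurable_EFinP.
  + apply: (emeasurable_fun_cvg (fun n => EFin \o f n)).
    * by move=> n; exact/measurable_EFinP.
    * move=> x _; apply: ereal_nondecreasing_is_cvgn => m n mn; rewrite lee_fin; exact: ndf.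
  + move=> x _; have [n gn] := gf x.
    apply: (@le_trans _ _ (f n x)%:E); first by rewrite lee_fin.
    have nd : nondecreasing_seq (fun n => (f n x)%:E).
      by move=> i j ij; rewrite lee_fin; exact: ndf.
    rewrite (cvg_lim _ (ereal_nondecreasing_cvgn nd))//.
    by apply: ereal_sup_ubound; exists n.
- by move=> n; exact/measurable_EFinP.
- by move=> n x _; rewrite lee_fin.
- by move=> x _ i j ij; rewrite lee_fin; exact: ndf.
Qed.

End NonnegIntegrals.

Lemma powRDp {R : realType} (x a b : R) : 0 < x -> x `^ a * x `^ b = x `^ (a + b).
Proof. by move=> x0; rewrite powRD// (gt_eqF x0) implybT. Qed.

(** * Doob's inequality *)

Section Martingale.
Context {d : measure_display} {T : measurableType d} {R : realType}.
Variables (mu : {finite_measure set T -> \bar R}) (F : nat -> set (set T)).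
Hypothesis hF : filtration F.

Local Notation I := (Int mu).

(** Stated on the type generated by [F n], so that the closure properties of [measurable_fun] apply;
    [measurable_wrtE] relates it to [measurable_wrt]. *)
Definition adapted n (f : T -> R) : Prop :=
  @measurable_fun _ _ (g_sigma_algebraType (F n)) R setT f.

Lemma adapted_measurable n f : adapted n f -> measurable_fun setT f.
Proof. by have [sF [FT _]] := hF; apply: measurable_sub => //; exact: FT. Qed.

Lemma adapted_le n m f : (n <= m)%N -> adapted n f -> adapted m f.
Proof.
have [sF [_ Fnm]] := hF; move=> nm /(measurable_wrtE (sF n)) mf.
by apply/(measurable_wrtE (sF m)) => B mB; apply: (Fnm _ _ nm); exact: mf.
Qed.

(* E_n u <= E_n v almost everywhere, expressed by testing against nonnegative
   F_n-measurable factors so that no version has to be chosen. *)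
Definition cond_le n (u v : T -> R) : Prop :=
  forall c : T -> R, (forall x, 0 <= c x) -> adapted n c ->
    (I (fun x => c x * u x)%R <= I (fun x => c x * v x)%R)%E.

Lemma cond_leP n (u v : T -> R) : measurable_fun setT u -> measurable_fun setT v ->
  (forall x, 0 <= u x) -> (forall x, 0 <= v x) ->
  (forall A, F n A -> \int[mu]_(x in A) (u x)%:E <= \int[mu]_(x in A) (v x)%:E)%E ->
  cond_le n u v.
Proof.
move=> mu_ mv u0 v0 uv c c0 mc; have [sF [FT _]] := hF.
rewrite /Int; under eq_integral do rewrite EFinM.
under [leRHS]eq_integral do rewrite EFinM.
apply: (le_integral_mul_sub (sF n) (FT n)) => //;
  by [exact/measurable_EFinP|move=> x; rewrite lee_fin].
Qed.

(* With a_n the running maximum truncated at a level k, pathwise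
     a_(n+1)^p - a_n^p <= p/(p-1) x_n (a_(n+1)^(p-1) - a_n^(p-1)),
   and the last factor is F_n-measurable.  The truncation only serves to make the
   left-hand integral finite, so that it can be absorbed. *)
Lemma doob (p : R) : 1 < p -> exists2 D : R, 0 < D &
  forall N (rho phi : T -> R) (x : nat -> T -> R),
  measurable_fun setT rho -> (forall t, 0 <= rho t) -> (I rho < +oo)%E ->
  measurable_fun setT phi -> (forall t, 0 <= phi t) ->
  (forall n, adapted n (x n)) -> (forall n t, 0 <= x n t) ->
  (forall n, (n < N)%N -> cond_le n (fun t => x n t * rho t) (fun t => phi t * rho t)) ->
  (I (fun t => runmax (x ^~ t) N `^ p * rho t)%R <=
   D%:E * I (fun t => phi t `^ p * rho t)%R)%E.
Proof.
move=> p1; have p0 : 0 < p by lra.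
have p10 : 0 < p - 1 by lra.
pose q := p / (p - 1); have q0 : 0 < q by rewrite divr_gt0.
have pV : 0 < p^-1 <= 1 by rewrite invr_gt0 p0 invf_le1//= ltW.
(* With this e, the factor q of [step] leaves exactly 1/2 in front of the integral to be
   absorbed. *)
have e0 : 0 < (2 * q)^-1 by rewrite invr_gt0 mulr_gt0.
have [D D0 hD] := powR_mean_eps pV e0.
exists (2 * (q * D)); first by rewrite mulr_gt0// mulr_gt0.
move=> N rho phi x mrho rho0 rhoi mphi phi0 ax x0 hx.
have mx n : measurable_fun setT (x n) by exact: adapted_measurable (ax n).
pose a k n t := Num.min k%:R (runmax (x ^~ t) n) : R.
have a0 k n t : 0 <= a k n t by rewrite le_min ler0n runmax_ge0.
have ma k n : measurable_fun setT (a k n).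
  by apply: measurable_minr; [exact: measurable_cst|apply: measurable_runmax => *; exact: mx].
have step k n : (n <= N)%N ->
    (I (fun t => a k n t `^ p * rho t)%R <=
     q%:E * I (fun t => a k n t `^ (p - 1) * (phi t * rho t))%R)%E.
  elim: n => [_|n IH nN].
    rewrite (_ : I _ = 0%E) ?mule_ge0 ?lee_fin ?(ltW q0)//.
      by apply: Int_ge0 => t; rewrite !mulr_ge0 ?powR_ge0.
    rewrite -(integral0 mu setT); apply: eq_integral => t _.
    by rewrite /a /= min_r// powR0 ?mul0r// gt_eqF.
  pose c t := a k n.+1 t `^ (p - 1) - a k n t `^ (p - 1).
  have aS t : a k n t <= a k n.+1 t.
    by rewrite /a /= le_min !ge_min !le_max !lexx /= ?orbT.
  have c0 t : 0 <= c t by rewrite subr_ge0 ge0_ler_powR ?nnegrE// ltW.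
  (* [a k n.+1] involves only the x_i with i <= n, so the increment [c] is a legitimate test factor
     for [hx] at time n. *)
  have adc : adapted n c.
    have adm m : (m <= n.+1)%N -> adapted n (a k m).
      move=> mn; apply: measurable_minr; first exact: measurable_cst.
      apply: measurable_runmax => i im; apply: (@adapted_le i) => //.
      by rewrite -ltnS (leq_trans im).
    by apply: measurable_funB; apply: measurable_powRf; apply: adm.
  have mc := adapted_measurable adc.
  apply: (@le_trans _ _ (I (fun t => a k n t `^ p * rho t)%R +
     q%:E * I (fun t => c t * (x n t * rho t))%R)%E).
    rewrite -IntZ ?(ltW q0)//; [|by mfun|by pos].
    rewrite -IntD; [|by mfun|by mfun|by pos
      |by pos].
    apply: Int_le; [by mfun|by mfun|by pos|move=> t].
    rewrite mulrA [X in _ + X](_ : _ = q * (x n t * c t) * rho t); last by ring.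
    rewrite -mulrDl ler_wpM2r// -lerBlDl.
    apply: (le_trans (powR_increment p1 (a0 k n t) (aS t))).
    rewrite ler_wpM2l ?(ltW q0)//.
    (* The running maximum grows only if x_n exceeds it, and its new value is then x_n up to the
       truncation. Otherwise both sides vanish. *)
    have [ax_|xa] := leP (runmax (x ^~ t) n) (x n t).
      by rewrite ler_wpM2r ?c0// /a /= max_r// ge_min lexx orbT.
    have -> : c t = 0 by rewrite /c /a /= max_l ?subrr// ltW.
    have -> : a k n.+1 t `^ (p - 1) - a k n t `^ (p - 1) = 0.
      by rewrite /a /= max_l ?subrr// ltW.
    by rewrite !mulr0.
  apply: (@le_trans _ _ (q%:E * I (fun t => a k n t `^ (p - 1) * (phi t * rho t))%R +
     q%:E * I (fun t => c t * (phi t * rho t))%R)%E).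
    apply: leeD; first by apply: IH; exact: ltnW.
    by rewrite lee_wpmul2l ?lee_fin ?(ltW q0)//; exact: hx.
  rewrite -muleDr//; last first.
    by apply: ge0_adde_def; rewrite inE; apply: Int_ge0 => t; rewrite !mulr_ge0 ?powR_ge0.
  rewrite -IntD; [|by mfun|by mfun|by pos
    |by pos].
  by rewrite (@eq_Int _ _ _ _ _ (fun t => a k n.+1 t `^ (p - 1) * (phi t * rho t)))// => t; rewrite /c; ring.
have bound k : (I (fun t => a k N t `^ p * rho t)%R <=
    (2 * (q * D))%:E * I (fun t => phi t `^ p * rho t)%R)%E.
  set A := I (fun t => a k N t `^ p * rho t)%R.
  set B := I (fun t => phi t `^ p * rho t)%R.
  have B0 : (0 <= B)%E by apply: Int_ge0 => t; rewrite mulr_ge0 ?powR_ge0.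
  have A0 : (0 <= A)%E by apply: Int_ge0 => t; rewrite mulr_ge0 ?powR_ge0.
  have Afin : A \is a fin_num.
    rewrite ge0_fin_numE//; apply: (@le_lt_trans _ _ ((k%:R `^ p)%:E * I rho)%E).
      rewrite -IntZ; [|by mfun|by pos|exact: powR_ge0].
      apply: Int_le;
        [by mfun|by mfun|by pos|move=> t].
      rewrite ler_wpM2r// ge0_ler_powR ?nnegrE ?(ltW p0)//.
      by rewrite /a ge_min lexx.
    by rewrite lte_mul_pinfty ?lee_fin ?powR_ge0.
  (* a^(p-1) phi is the geometric mean of phi^p and a^p with exponents 1/p and 1 - 1/p, so [hD]
     applies pointwise. *)
  have AB : (A <= (q * D)%:E * B + 2^-1%:E * A)%E.
    apply: (le_trans (step k N (leqnn N))).
    rewrite -!IntZ ?mulr_ge0 ?(ltW q0) ?(ltW D0) ?invr_ge0//;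
      try (by mfun); try (by pos).
    rewrite -IntD; try (by mfun);
      try (by pos).
    apply: Int_le; try (by mfun);
      try (by pos).
    move=> t; rewrite !mulrA -mulrDl ler_wpM2r//.
    have := hD (phi t `^ p) (a k N t `^ p) (powR_ge0 _ _) (powR_ge0 _ _).
    rewrite -!powRrM mulfV ?gt_eqF// powRr1//.
    rewrite (_ : p * (1 - p^-1) = p - 1); last by rewrite mulrBr mulr1 mulfV// gt_eqF.
    move=> h; rewrite (_ : _ * _ * _ = q * (phi t * a k N t `^ (p - 1))); last by ring.
    rewrite [leRHS](_ : _ = q * (D * phi t `^ p + (2 * q)^-1 * a k N t `^ p)).
      by rewrite (ler_pM2l q0).
    by field; rewrite gt_eqF.
  by apply: (absorb_half _ Afin B0 AB); apply: mulr_gt0.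
apply: (@Int_sup _ _ _ _ (fun k t => a k N t `^ p * rho t)) => //.
- by move=> k; mfun.
- by move=> k t; rewrite mulr_ge0 ?powR_ge0.
- move=> t m n mn; rewrite ler_wpM2r// ge0_ler_powR ?nnegrE ?(ltW p0)//.
  by rewrite /a le_min !ge_min ler_nat mn lexx orbT.
- move=> t; exists (Num.truncn (runmax (x ^~ t) N)).+1.
  by rewrite /a min_r// ltW// truncnS_gt.
- apply: measurable_funM => //; apply: measurable_powRf.
  by apply: measurable_runmax => *; exact: mx.
- by pos.
Qed.

End Martingale.

(** * Weighted maximal inequality *)

Section ScalarMaximal.
Context {d : measure_display} {T : measurableType d} {R : realType}.
Variables (mu : {finite_measure set T -> \bar R}) (F : nat -> set (set T)).
Hypothesis hF : filtration F.

Local Notation I := (Int mu).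
Local Notation adapted := (adapted F).
Local Notation cond_le := (cond_le mu F).

Definition dualw (p : R) (v : T -> R) (x : T) : R := v x `^ (- (p - 1)^-1).

(* The A_p condition up to time N: [b n] dominates E_n of the dual weight, and the
   last condition says (b n)^(p-1) E_n v <= K. *)
Record good_weight (p K : R) (N : nat) (v : T -> R) : Prop := GoodWeight {
  gw_gt0 : forall x, 0 < v x;
  gw_meas : measurable_fun setT v;
  gw_int : (I v < +oo)%E;
  gw_dual_int : (I (dualw p v) < +oo)%E;
  gw_ex : exists b : nat -> T -> R, [/\ forall n, adapted n (b n), forall n x, 0 < b n x,
    forall n, (n < N)%N -> cond_le n (dualw p v) (b n) &
    forall n, (n < N)%N -> cond_le n (fun x => b n x `^ (p - 1) * v x) (cst K)] }.

Lemma dualw_gt0 p v x : 0 < v x -> 0 < dualw p v x.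
Proof. exact: powR_gt0. Qed.

Lemma weighted_maximal (p K : R) : 1 < p -> 0 < K -> exists2 C : R, 0 < C &
  forall N (v f : T -> R) (e : nat -> T -> R), good_weight p K N v ->
  measurable_fun setT f -> (forall x, 0 <= f x) ->
  (forall n, adapted n (e n)) -> (forall n x, 0 <= e n x) ->
  (forall n, (n < N)%N -> cond_le n (e n) f) ->
  (I (fun x => runmax (e ^~ x) N `^ p * v x)%R <= C%:E * I (fun x => f x `^ p * v x)%R)%E.
Proof.
move=> p1 K0; have p0 : 0 < p by lra.
have s0 : 0 < p - 1 by lra.
pose q := p / (p - 1).
have q1 : 1 < q by rewrite ltr_pdivlMr// mul1r; lra.
have [D1 D10 doob1] := doob mu hF p1; have [D2 D20 doob2] := doob mu hF q1.
have C0 : 0 < D2 * (K `^ q * D1) by rewrite mulr_gt0// mulr_gt0// powR_gt0.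
exists (D2 * (K `^ q * D1)) => // N v f e [v0 mv vi ti [b [ab b0 tb bv]]] mf f0 ae e0 ef.
have t0 x : 0 < dualw p v x by exact: dualw_gt0.
have mt : measurable_fun setT (dualw p v) by exact: measurable_powRf.
have me n : measurable_fun setT (e n) by exact: adapted_measurable (ae n).
have mb n : measurable_fun setT (b n) by exact: adapted_measurable (ab n).
(* [x n] plays the part of E_n^s(f/s), with [b n] in place of E_n s. *)
pose x n t := e n t * b n t `^ (-1).
pose X t := runmax (x ^~ t) N.
have x0 n t : 0 <= x n t by rewrite mulr_ge0 ?powR_ge0.
have X0 t : 0 <= X t by exact: runmax_ge0.
have ax n : adapted n (x n).
  by apply: measurable_funM; [exact: ae|apply: measurable_powRf; exact: ab].
have mx n : measurable_fun setT (x n) by exact: adapted_measurable (ax n).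
have mX : measurable_fun setT X by apply: measurable_runmax => n _; exact: mx.
have tE t : dualw p v t `^ (1 - p) = v t.
  rewrite -powRrM (_ : _ * _ = 1) ?powRr1 ?ltW//.
  by field; rewrite gt_eqF.
have vE t : v t `^ (1 - q) = dualw p v t.
  by congr (_ `^ _); rewrite /q; field; rewrite gt_eqF.
(* Doob's inequality for s dP and phi = f/s; since s^(1-p) = v, the integrand (f/s)^p s is f^p v. *)
have step1 : (I (fun t => X t `^ p * dualw p v t)%R <= D1%:E * I (fun t => f t `^ p * v t)%R)%E.
  have -> : I (fun t => f t `^ p * v t) =
      I (fun t => (f t * dualw p v t `^ (-1)) `^ p * dualw p v t).
    apply: eq_Int => t; rewrite powRM ?powR_ge0// -powRrM mulN1r -mulrA -(tE t).
    by congr (_ * _); rewrite -[X in _ * X]powRr1 ?ltW// powRDp// addrC.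
  apply: doob1 => //.
  - by move=> t; exact: ltW.
  - by mfun.
  - by move=> t; rewrite mulr_ge0 ?powR_ge0.
  - move=> n nN c c0 ac; have mc := adapted_measurable hF ac.
    pose c' t := c t * x n t.
    have c'0 t : 0 <= c' t by apply: mulr_ge0; [exact: c0|exact: x0].
    have ac' : adapted n c' := measurable_funM ac (ax n).
    have h1 : (I (fun t => c t * (x n t * dualw p v t))%R <= I (fun t => c t * e n t)%R)%E.
      rewrite (@eq_Int _ _ _ _ _ (fun t => c' t * dualw p v t)); last by move=> t; rewrite mulrA.
      apply: (le_trans (tb n nN c' c'0 ac')).
      rewrite (@eq_Int _ _ _ _ _ (fun t => c t * e n t))// => t.
      by rewrite /c' /x -!mulrA powR_inv1 ?ltW// mulVf ?mulr1// gt_eqF.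
    apply: (le_trans h1); apply: (le_trans (ef n nN c c0 ac)).
    rewrite (@eq_Int _ _ _ _ (fun t => c t * f t) (fun t => c t * (f t * dualw p v t `^ (-1) * dualw p v t)))// => t.
    by rewrite powR_inv1 ?ltW// mulfVK// gt_eqF.
(* As q (p-1) = p, the sequence e_n^(p-1) is to be estimated in L^q(v), by Doob's inequality for v
   dP. *)
have runE t : runmax (e ^~ t) N `^ p = runmax (fun n => e n t `^ (p - 1)) N `^ q.
  rewrite -(@runmax_homo _ (e ^~ t) (fun a => a `^ (p - 1))).
  - by rewrite -powRrM /q mulrC mulfVK// gt_eqF.
  - by rewrite powR0// gt_eqF.
  - move=> a a' /andP[a0 aa']; by rewrite ge0_ler_powR ?nnegrE ?(ltW s0) ?(le_trans a0 aa').
  - by move=> n _.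
rewrite (@eq_Int _ _ _ _ _ (fun t => runmax (fun n => e n t `^ (p - 1)) N `^ q * v t)); last first.
  by move=> t; rewrite runE.
have h2 := @doob2 N v (fun t => K * (X t `^ (p - 1) * v t `^ (-1)))
   (fun n t => e n t `^ (p - 1)) mv (fun t => ltW (v0 t)) vi.
apply: le_trans; first apply: h2.
- by mfun.
- by move=> t; rewrite !mulr_ge0 ?powR_ge0 ?ltW.
- by move=> n; apply: measurable_powRf; exact: ae.
- by move=> n t; exact: powR_ge0.
- move=> n nN c c0 ac; have mc := adapted_measurable hF ac.
  (* Because x_n b_n = e_n, this factor turns b_n^(p-1) v into e_n^(p-1) v. Hence E_n(e_n^(p-1) v)
     <= K x_n^(p-1), and x_n <= X. *)
  pose c' t := c t * x n t `^ (p - 1).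
  have c'0 t : 0 <= c' t by apply: mulr_ge0; [exact: c0|exact: powR_ge0].
  have ac' : adapted n c' := measurable_funM ac (measurable_powRf (p - 1) (ax n)).
  have := bv n nN c' c'0 ac'; rewrite /cst /=.
  rewrite (@eq_Int _ _ _ _ _ (fun t => c t * (e n t `^ (p - 1) * v t))); last first.
    move=> t; rewrite /c' /x powRM ?powR_ge0// -powRrM mulN1r.
    rewrite -!mulrA; congr (_ * (_ * _)); rewrite mulrA powRDp// addNr powRr0 mul1r//.
  move=> /le_trans; apply; apply: Int_le.
  + by rewrite /c'; mfun.
  + by mfun.
  + by move=> t; rewrite mulr_ge0// ltW.
  + move=> t; rewrite powR_inv1 ?(ltW (v0 t))//.
    rewrite [leRHS](_ : _ = c t * X t `^ (p - 1) * K); last by field; rewrite gt_eqF.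
    rewrite ler_wpM2r ?(ltW K0)// ler_wpM2l//.
    rewrite ge0_ler_powR ?nnegrE ?(ltW s0)//.
    exact: (@le_runmax _ (x ^~ t)).
(* (K X^(p-1) / v)^q v = K^q X^p s because v^(1-q) = s; [step1] then bounds the integral. *)
- rewrite (@eq_Int _ _ _ _ _ (fun t => K `^ q * (X t `^ p * dualw p v t))); last first.
    move=> t; rewrite !powRM ?mulr_ge0 ?powR_ge0 ?ltW// -!powRrM mulN1r -!mulrA.
    congr (_ * (_ * _)); first by rewrite /q mulrC mulfVK// gt_eqF.
    by rewrite -(vE t) -[X in _ * X]powRr1 ?ltW// powRDp// addrC.
  rewrite IntZ ?powR_ge0//; [|by mfun|by move=> t; rewrite mulr_ge0 ?powR_ge0 ?ltW].
  rewrite [in leRHS]EFinM [in leRHS]EFinM -!muleA.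
  by do 2 (rewrite lee_wpmul2l ?lee_fin ?powR_ge0 ?(ltW D20)//).
Qed.

End ScalarMaximal.

(** * Rubio de Francia's iteration *)

Section NonnegSeries.
Context {R : realType}.
Implicit Types u : nat -> R.

Definition ser u : \bar R := (\sum_(0 <= k <oo) (u k)%:E)%E.

Lemma ser_le u B : (forall k, 0 <= u k) ->
  (forall L, (\sum_(k < L) u k)%:E <= B)%E -> (ser u <= B)%E.
Proof.
move=> u0 uB; apply: lime_le.
  by apply: is_cvg_nneseries => n _ _; rewrite lee_fin.
by apply: nearW => L; rewrite sumEFin big_mkord.
Qed.

Lemma le_ser u L : (forall k, 0 <= u k) -> ((\sum_(k < L) u k)%:E <= ser u)%E.
Proof.
move=> u0; rewrite -(big_mkord predT) -sumEFin; apply: nneseries_lim_ge => n _ _.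
by rewrite lee_fin.
Qed.

Lemma ser_ge0 u : (forall k, 0 <= u k) -> (0 <= ser u)%E.
Proof. by move=> u0; apply: nneseries_ge0 => n _ _; rewrite lee_fin. Qed.

Lemma mul_ser c u : (forall k, 0 <= u k) -> (c%:E * ser u = ser (fun k => c * u k)%R)%E.
Proof.
move=> u0; rewrite /ser -nneseriesZl//; last by move=> k _; rewrite lee_fin.
Qed.

Lemma powR_add_le (p a b : R) : 0 <= p -> 0 <= a -> 0 <= b ->
  (a + b) `^ p <= 2 `^ p * (a `^ p + b `^ p).
Proof.
move=> p0 a0 b0; pose m := Num.max a b.
have m0 : 0 <= m by rewrite le_max a0.
apply: (@le_trans _ _ ((2 * m) `^ p)).
  rewrite ge0_ler_powR ?nnegrE ?addr_ge0 ?mulr_ge0//.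
  by rewrite mulr2n mulrDl !mul1r lerD// le_max lexx ?orbT.
rewrite powRM// ler_wpM2l ?powR_ge0// /m.
by have [_|_] := leP a b; rewrite ?lerDl ?lerDr powR_ge0.
Qed.

(** A substitute for Minkowski's inequality. Splitting off the first term and factoring h out of the
    rest costs 2^p each time, so the k-th term collects (2h)^(pk). *)
Lemma powR_geom_sum_le (p h : R) L u : 0 < p -> 0 <= h -> (forall k, 0 <= u k) ->
  (\sum_(k < L) h ^+ k * u k) `^ p <=
  \sum_(k < L) 2 `^ p * ((2 * h) `^ p) ^+ k * u k `^ p.
Proof.
move=> p0 h0; elim: L u => [|L IH] u u0.
  by rewrite !big_ord0 powR0 ?gt_eqF.
rewrite !big_ord_recl /= !expr0 mul1r mulr1.
rewrite (eq_bigr (fun k : 'I_L => h * (h ^+ k * u k.+1))); last first.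
  by move=> k _; rewrite /bump /= add1n exprS mulrA.
rewrite -big_distrr /=.
have S0 : 0 <= \sum_(k < L) h ^+ k * u k.+1.
  by apply: sumr_ge0 => k _; rewrite mulr_ge0 ?exprn_ge0.
apply: (le_trans (powR_add_le (ltW p0) (u0 _) (mulr_ge0 h0 S0))).
rewrite mulrDr lerD2l [in leLHS]powRM// mulrA -powRM//.
apply: (le_trans (ler_wpM2l (powR_ge0 _ _) (IH (fun k => u k.+1) _))) => //.
rewrite big_distrr /= ler_sum// => k _.
by rewrite /bump /= add1n exprS !mulrA [_ * 2 `^ p]mulrC.
Qed.

Lemma half_geom_sum L : \sum_(k < L) (2^-1 : R) ^+ k <= 2.
Proof.
suff -> : \sum_(k < L) (2^-1 : R) ^+ k = 2 - 2 * 2^-1 ^+ L.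
  by rewrite gerBl mulr_ge0// exprn_ge0// invr_ge0.
elim: L => [|L IH]; first by rewrite big_ord0 expr0; lra.
by rewrite big_ord_recr /= IH exprS; lra.
Qed.

(** x is the geometric mean of the two summands with exponents 1/p and 1 - 1/p: the powers of v
    cancel. *)
Lemma le_Lp_weight (p x v : R) : 1 < p -> 0 <= x -> 0 < v ->
  x <= x `^ p * v + v `^ (- (p - 1)^-1).
Proof.
move=> p1 x0 v0; have p0 : 0 < p by lra.
have := @powR_mean_le R (x `^ p * v) (v `^ (- (p - 1)^-1)) p^-1
  (mulr_ge0 (powR_ge0 _ _) (ltW v0)) (powR_ge0 _ _).
rewrite invr_ge0 (ltW p0) /= invf_le1// (ltW p1) => /(_ isT); apply: le_trans.
rewrite powRM ?powR_ge0 ?(ltW v0)// -!powRrM mulfV ?gt_eqF// powRr1// -mulrA powRDp//.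
have -> : p^-1 + - (p - 1)^-1 * (1 - p^-1) = 0.
  by field; rewrite gt_eqF//= gt_eqF// subr_gt0.
by rewrite powRr0 mulr1.
Qed.

End NonnegSeries.

Section SeriesIntegral.
Context d (T : measurableType d) (R : realType) (mu : {measure set T -> \bar R}).

Lemma measurable_ser (f : nat -> T -> R) :
  (forall k, measurable_fun setT (f k)) -> (forall k x, 0 <= f k x) ->
  measurable_fun setT (fun x => ser (f ^~ x)).
Proof.
move=> mf f0; apply: ge0_emeasurable_sum.
- by move=> k x _ _; rewrite lee_fin.
- by move=> k _; exact/measurable_EFinP.
Qed.

Lemma Int_ser (f : nat -> T -> R) :
  (forall k, measurable_fun setT (f k)) -> (forall k x, 0 <= f k x) ->
  (\int[mu]_x ser (f ^~ x) = \sum_(0 <= k <oo) Int mu (f k))%E.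
Proof.
move=> mf f0; rewrite /ser integral_nneseries//.
- by move=> k; exact/measurable_EFinP.
- by move=> k x _; rewrite lee_fin.
Qed.

End SeriesIntegral.

Section RubioDeFrancia.
Context {d : measure_display} {T : measurableType d} {R : realType}.
Variables (mu : {finite_measure set T -> \bar R}) (F : nat -> set (set T)).
Hypothesis hF : filtration F.

Local Notation I := (Int mu).
Local Notation adapted := (adapted F).
Local Notation cond_le := (cond_le mu F).

Lemma exists_adapted_cond_exp (f : T -> R) :
  measurable_fun setT f -> (forall x, 0 <= f x) -> (I f < +oo)%E ->
  exists e : nat -> T -> R, [/\ forall n, adapted n (e n), forall n x, 0 <= e n x,
    forall n, cond_le n (e n) f & forall n, cond_le n f (e n)].
Proof.
move=> mf f0 fi; have [sF [FT _]] := hF.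
have [e he] := choice (fun n => exists_cond_exp (sF n) (FT n) mf f0 fi).
have e0 n x : 0 <= e n x by have [] := he n.
have ae n : adapted n (e n) by have [] := he n.
have me n : measurable_fun setT (e n) by exact: adapted_measurable (ae n).
exists e; split => // n; apply: (cond_leP hF) => // A FA; have [_ _ h] := he n; by rewrite h.
Qed.

(** It gives conditional expectations to each iterate of the maximal operator, and integrability to
    the majorant H. *)
Lemma Lp_weight_integrable (p : R) (v f : T -> R) : 1 < p ->
  measurable_fun setT v -> (forall x, 0 < v x) -> (I (dualw p v) < +oo)%E ->
  measurable_fun setT f -> (forall x, 0 <= f x) ->
  (I (fun x => f x `^ p * v x)%R < +oo)%E -> (I f < +oo)%E.
Proof.
move=> p1 mv v0 ti mf f0 fi.
have mt : measurable_fun setT (dualw p v) by exact: measurable_powRf.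
apply: (@le_lt_trans _ _ (I (fun x => f x `^ p * v x)%R + I (dualw p v))%E).
  rewrite -IntD//; [|by mfun|by move=> x; rewrite mulr_ge0 ?powR_ge0// ltW
    |by move=> x; exact: powR_ge0].
  by apply: Int_le => //; [mfun|move=> x; exact: le_Lp_weight].
exact: lte_add_pinfty.
Qed.

(* H is the series sum_k h^k M^k f, enlarged pointwise so that [eta n <= C * H] holds
   everywhere, in particular on the null set where the series diverges and [fine]
   returns 0. *)
Lemma rubio_de_francia (p K : R) : 1 < p -> 0 < K -> exists2 C : R, 0 < C &
  forall N (v f : T -> R) (eps : R), good_weight mu F p K N v ->
  measurable_fun setT f -> 0 < eps -> (forall x, eps <= f x) ->
  (I (fun x => f x `^ p * v x)%R < +oo)%E ->
  exists (H : T -> R) (eta : nat -> T -> R),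
  [/\ measurable_fun setT H, forall x, f x <= H x,
      (I (fun x => H x `^ p * v x)%R <= C%:E * I (fun x => f x `^ p * v x)%R)%E,
      (forall n, adapted n (eta n)) /\ (forall n x, 0 < eta n x) &
      forall n, (n < N)%N -> (forall x, eta n x <= C * H x) /\ cond_le n H (eta n)].
Proof.
move=> p1 K0; have p0 : 0 < p by lra.
have [A0 A00 hA0] := weighted_maximal mu hF p1 K0.
(* The added 1 ensures A >= 1, from which h <= 1. *)
pose A := A0 + 1; have A1 : 1 <= A by rewrite /A lerDr ltW.
have Agt0 : 0 < A by lra.
(* Chosen so that (2h)^p = 1/(2A). The integral of X_k^p v grows at most like A^k, so the series of
   [powR_geom_sum_le] has ratio 1/2 after integration. *)
pose h := (2 * A) `^ (- p^-1) / 2.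
have h0 : 0 < h by rewrite divr_gt0// powR_gt0// mulr_gt0.
have h2p : (2 * h) `^ p = (2 * A)^-1.
  rewrite /h mulrCA mulfV// mulr1 -powRrM mulNr mulVf ?gt_eqF// powR_inv1//; lra.
have h1 : h <= 1.
  rewrite /h ler_pdivrMr// mul1r powRN.
  apply: (@le_trans _ _ 1); last by lra.
  rewrite invf_le1 ?powR_gt0 ?mulr_gt0//.
  by rewrite -[leLHS](powRr0 (2 * A)) ler_powR ?invr_ge0 ?(ltW p0)//; lra.
have hV1 : 1 <= h^-1 by rewrite invf_ge1.
have hV0 : 0 < h^-1 by rewrite invr_gt0.
(* The first summand serves the norm of H, the second the bound eta <= C H. *)
pose C := h^-1 `^ p * (2 `^ p * 2) + h^-1.
have C10 : 0 < h^-1 `^ p * (2 `^ p * 2) by rewrite mulr_gt0 ?powR_gt0// mulr_gt0// powR_gt0.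
have C0 : 0 < C by rewrite addr_gt0.
exists C => // N v f eps gv mf eps0 epsf fi.
have [v0 mv vi ti _] := gv.
have f0 x : 0 <= f x by rewrite (le_trans (ltW eps0)).
have [B BE] : exists B, B = I (fun x => f x `^ p * v x) := ex_intro _ _ erefl.
rewrite -BE in fi *.
have B0 : (0 <= B)%E by rewrite BE; apply: Int_ge0 => x; rewrite mulr_ge0 ?powR_ge0// ltW.
pose Pf (g : T -> R) := [/\ measurable_fun setT g, forall x, 0 <= g x &
  (I (fun x => g x `^ p * v x)%R < +oo)%E].
(* The choice of conditional expectations must be total in g; outside [Pf] it is 0, and every
   iterate lies in [Pf]. *)
have exE g : exists e : nat -> T -> R, Pf g ->
  [/\ forall n, adapted n (e n), forall n x, 0 <= e n x,
    forall n, cond_le n (e n) g & forall n, cond_le n g (e n)].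
  have [[mg g0 gi]|nPg] := pselect (Pf g); last by exists (fun _ _ => 0).
  have [e he] := exists_adapted_cond_exp mg g0 (Lp_weight_integrable p1 mv v0 ti mg g0 gi).
  by exists e.
have [E hE] := choice exE.
have [X [XZ XS]] : exists X : nat -> T -> R,
    X 0%N = f /\ forall k, X k.+1 = fun x => runmax (E (X k) ^~ x) N.
  by exists (fun k => iter k (fun g x => runmax (E g ^~ x) N) f).
have PX k : Pf (X k) /\ (I (fun x => X k x `^ p * v x)%R <= (A ^+ k)%:E * B)%E.
  elim: k => [|k [PXk XkB]].
    by rewrite XZ expr0 mul1e -BE; split => //; split => //; rewrite -BE.
  have [aE E0 E1 E2] := hE _ PXk; have [mXk Xk0 Xki] := PXk.
  have mXS : measurable_fun setT (X k.+1).
    by rewrite XS; apply: measurable_runmax => n _; exact: adapted_measurable (aE n).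
  have XS0 x : 0 <= X k.+1 x by rewrite XS; exact: runmax_ge0.
  have b : (I (fun x => X k.+1 x `^ p * v x)%R <= (A ^+ k.+1)%:E * B)%E.
    rewrite XS.
    apply: (le_trans (hA0 N v (X k) (E (X k)) gv mXk Xk0 aE E0 (fun n _ => E1 n))).
    rewrite exprS EFinM -muleA.
    apply: (@le_trans _ _ (A%:E * I (fun x => X k x `^ p * v x)%R)%E).
      apply: lee_wpmul2r; last by rewrite lee_fin lerDl.
      by apply: Int_ge0 => x; rewrite mulr_ge0 ?powR_ge0// ltW.
    by apply: lee_wpmul2l => //; rewrite lee_fin ltW.
  split; [split; [exact: mXS|exact: XS0|]|exact: b].
  apply: (le_lt_trans b); apply: lte_mul_pinfty => //.
  by rewrite lee_fin exprn_ge0// ltW.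
have mX k : measurable_fun setT (X k) by have [[]] := PX k.
have X0 k x : 0 <= X k x by have [[]] := PX k.
have aE k n : adapted n (E (X k) n) by have [/hE[]] := PX k.
have E0 k n x : 0 <= E (X k) n x by have [/hE[]] := PX k.
have EX k n : cond_le n (E (X k) n) (X k) by have [/hE[]] := PX k.
have XE k n : cond_le n (X k) (E (X k) n) by have [/hE[]] := PX k.
have mE k n : measurable_fun setT (E (X k) n) by exact: adapted_measurable (aE k n).
pose uS x k := h ^+ k * X k x.
pose uE n x k := h ^+ k * E (X k) n x.
have hk0 k : 0 <= h ^+ k by rewrite exprn_ge0// ltW.
have uS0 x k : 0 <= uS x k by rewrite mulr_ge0.
have uE0 n x k : 0 <= uE n x k by rewrite mulr_ge0.
have muS k : measurable_fun setT (uS ^~ k) by rewrite /uS; mfun.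
have muE n k : measurable_fun setT (uE n ^~ k) by rewrite /uE; mfun.
pose S x := ser (uS x).
pose W n x := ser (uE n x).
(* E_n X_k <= X_(k+1) for n < N shifts the series by one index, at the price of 1/h. *)
have WS n x : (n < N)%N -> (W n x <= h^-1%:E * S x)%E.
  move=> nN; rewrite /W; apply: ser_le => // L.
  apply: (@le_trans _ _ (h^-1%:E * (\sum_(k < L.+1) uS x k)%:E)%E); last first.
    by rewrite lee_wpmul2l ?lee_fin ?(ltW hV0)//; exact: le_ser.
  rewrite -EFinM lee_fin big_ord_recl mulrDr big_distrr /=.
  rewrite ler_wpDl ?mulr_ge0 ?(ltW hV0)// ler_sum// => k _.
  rewrite /bump /= add1n /uS exprS -mulrA mulKf ?gt_eqF// ler_wpM2l// XS.
  exact: (@le_runmax _ (E (X k) ^~ x)).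
have fS x : ((f x)%:E <= S x)%E.
  by have := le_ser 1 (uS0 x); rewrite big_ord_recl big_ord0 addr0 /uS expr0 mul1r XZ.
have aW n : adapted n (fine \o W n).
  apply: measurableT_comp => //.
  apply: (measurable_ser (T := g_sigma_algebraType (F n)) (f := fun k x => uE n x k)) => // k.
  by apply: measurable_funM; [exact: measurable_cst|exact: aE].
have mS : measurable_fun setT S by apply: (measurable_ser (f := fun k x => uS x k)).
have mW n : measurable_fun setT (W n) by apply: (measurable_ser (f := fun k x => uE n x k)).
have mfW n : measurable_fun setT (fine \o W n) by exact: adapted_measurable (aW n).
pose H x := Num.max (fine (S x)) (Num.max (f x) (runmax (fun n => fine (W n x)) N)).
pose eta n x := Num.max (h^-1 * fine (W n x)) eps.
have mH : measurable_fun setT H.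
  apply: measurable_maxr; first by apply: measurableT_comp.
  by apply: measurable_maxr => //; apply: measurable_runmax => n _; exact: mfW.
have H0 x : 0 <= H x by rewrite le_max orbC le_max f0.
have S0 x : (0 <= S x)%E by exact: ser_ge0.
have W0 n x : (0 <= W n x)%E by exact: ser_ge0.
(* The majorant of S^p v given by [powR_geom_sum_le]. Its integrability makes S finite almost
   everywhere. *)
pose D x := ser (fun k => 2 `^ p * ((2 * A)^-1) ^+ k * (X k x `^ p * v x)).
have t0 k : 0 <= 2 `^ p * ((2 * A)^-1) ^+ k.
  by rewrite mulr_ge0 ?powR_ge0// exprn_ge0// invr_ge0 mulr_ge0// ltW.
have XV0 k x : 0 <= X k x `^ p * v x by rewrite mulr_ge0 ?powR_ge0// ltW.
have D0 x : (0 <= D x)%E by apply: ser_ge0 => k; exact: mulr_ge0.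
have mD : measurable_fun setT D.
  apply: (measurable_ser (f := fun k x => 2 `^ p * ((2 * A)^-1) ^+ k * (X k x `^ p * v x))).
  - by move=> k; mfun.
  - by move=> k x; exact: mulr_ge0.
have Dint : (\int[mu]_x D x <= (2 `^ p * 2)%:E * B)%E.
  have [b [b0 Bb]] : exists b, 0 <= b /\ B = b%:E.
    exists (fine B); split; first exact: fine_ge0.
    by rewrite fineK// ge0_fin_numE.
  rewrite (@Int_ser _ _ _ mu (fun k x => 2 `^ p * ((2 * A)^-1) ^+ k * (X k x `^ p * v x))).
  - apply: (@le_trans _ _ (ser (fun k => 2 `^ p * b * 2^-1 ^+ k))).
      apply: lee_nneseries => k _.
        by move=> _; apply: Int_ge0 => x; exact: mulr_ge0.
      rewrite IntZ//; last by mfun.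
      have [_ XkB] := PX k.
      apply: (le_trans (lee_wpmul2l _ XkB)); first by rewrite lee_fin.
      rewrite Bb -!EFinM lee_fin invfM exprMn (exprVn A).
      have : A ^+ k != 0 by rewrite expf_neq0// gt_eqF.
      move: (A ^+ k) ((2^-1 : R) ^+ k) => a u a0.
      by rewrite (_ : _ * (a * b) = 2 `^ p * b * u)//; field.
    apply: ser_le => [k|L]; first by rewrite !mulr_ge0 ?powR_ge0// exprn_ge0// invr_ge0.
    rewrite Bb -EFinM lee_fin -big_distrr /= mulrAC ler_wpM2r//.
    by rewrite ler_wpM2l ?powR_ge0//; exact: half_geom_sum.
  - by move=> k; mfun.
  - by move=> k x; exact: mulr_ge0.
have good : {ae mu, forall x, D x \is a fin_num}.
  have Dintegrable : mu.-integrable setT D.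
    apply/integrableP; split => //; under eq_integral do rewrite gee0_abs//.
    by apply: (le_lt_trans Dint); apply: lte_mul_pinfty => //; rewrite lee_fin mulr_ge0// powR_ge0.
  have := integrable_ae measurableT Dintegrable.
  by apply: filterS => x; apply.
have goodS x : D x \is a fin_num -> S x \is a fin_num /\ fine (S x) `^ p * v x <= fine (D x).
  move=> Dx; pose M := (fine (D x) / v x) `^ p^-1.
  have SM : (S x <= M%:E)%E.
    apply: ser_le => // L; rewrite lee_fin.
    have U0 : 0 <= \sum_(k < L) uS x k by exact: sumr_ge0.
    rewrite -[leLHS](@powRr1) // -(@mulfV _ p) ?gt_eqF// powRrM.
    rewrite ge0_ler_powR ?nnegrE ?invr_ge0 ?(ltW p0) ?powR_ge0//.
      by rewrite divr_ge0 ?fine_ge0// ltW.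
    apply: (le_trans (powR_geom_sum_le L p0 (ltW h0) (X0 ^~ x))).
    rewrite ler_pdivlMr// h2p -lee_fin fineK//.
    rewrite big_distrl /=.
    rewrite (eq_bigr (fun k : 'I_L => 2 `^ p * ((2 * A)^-1) ^+ k * (X k x `^ p * v x))); last first.
      by move=> k _; rewrite !mulrA.
    by apply: (le_ser L (u := fun k => 2 `^ p * ((2 * A)^-1) ^+ k * (X k x `^ p * v x))) => k; exact: mulr_ge0.
  have Sfin : S x \is a fin_num by rewrite ge0_fin_numE// (le_lt_trans SM) ?ltry.
  split => //; rewrite -ler_pdivlMr//.
  have -> : fine (D x) / v x = M `^ p.
    by rewrite /M -powRrM mulVf ?gt_eqF// powRr1// divr_ge0 ?fine_ge0// ltW.
  rewrite ge0_ler_powR ?nnegrE ?(ltW p0) ?powR_ge0 ?fine_ge0//.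
  by rewrite -lee_fin fineK.
have goodW x n : (n < N)%N -> S x \is a fin_num -> W n x \is a fin_num /\ fine (W n x) <= h^-1 * fine (S x).
  move=> nN Sx; have := WS n x nN; rewrite -[S x]fineK// -EFinM => le.
  have Wfin : W n x \is a fin_num by rewrite ge0_fin_numE// (le_lt_trans le) ?ltry.
  split; first exact: Wfin.
  by move: le; rewrite -[W n x]fineK// lee_fin.
have goodH x : S x \is a fin_num -> H x <= h^-1 * fine (S x).
  move=> Sx; have Sle : fine (S x) <= h^-1 * fine (S x) by rewrite ler_peMl// fine_ge0.
  rewrite /H !ge_max Sle /=; apply/andP; split.
    by apply: le_trans Sle; rewrite -lee_fin fineK.
  apply: runmax_le => [|n nN]; first by rewrite mulr_ge0 ?(ltW hV0)// fine_ge0.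
  by have [] := goodW x n nN Sx.
exists H, eta; split => //.
- by move=> x; rewrite /H !le_max lexx orbT.
- apply: (@le_trans _ _ ((h^-1 `^ p)%:E * \int[mu]_x D x)%E).
    rewrite -ge0_integralZl//; last by rewrite lee_fin powR_ge0.
    apply: ae_ge0_le_integral => //.
    + by move=> x _; rewrite lee_fin mulr_ge0 ?powR_ge0// ltW.
    + by apply/measurable_EFinP; mfun.
    + by move=> x _; apply: mule_ge0 => //; rewrite lee_fin powR_ge0.
    + exact: measurable_funeM.
    + apply: filterS good => x Dx _; have [Sx SD] := goodS x Dx.
      rewrite -[D x]fineK// -EFinM lee_fin.
      apply: (@le_trans _ _ ((h^-1 * fine (S x)) `^ p * v x)).
        rewrite ler_wpM2r ?(ltW (v0 x))// ge0_ler_powR ?nnegrE ?(ltW p0)//.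
          by rewrite mulr_ge0 ?(ltW hV0)// fine_ge0.
        exact: goodH.
      by rewrite powRM ?(ltW hV0) ?fine_ge0// -mulrA ler_wpM2l ?powR_ge0.
  apply: (@le_trans _ _ ((h^-1 `^ p * (2 `^ p * 2))%:E * B)%E).
    by rewrite EFinM -muleA lee_wpmul2l// lee_fin powR_ge0.
  by apply: lee_wpmul2r => //; rewrite lee_fin lerDl ltW.
- split=> n; last by move=> x; rewrite lt_max eps0 orbT.
  apply: measurable_maxr; last exact: measurable_cst.
  by apply: measurable_funM; [exact: measurable_cst|exact: aW].
- move=> n nN; split.
    move=> x; apply: (@le_trans _ _ (h^-1 * H x)).
      rewrite ge_max ler_wpM2l ?(ltW hV0)//=.
        apply: (le_trans (epsf x)); apply: (@le_trans _ _ (H x)).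
          by rewrite /H !le_max lexx orbT.
        by rewrite ler_peMl.
      rewrite /H !le_max; apply/orP; right; apply/orP; right.
      exact: (@le_runmax _ (fun n => fine (W n x))).
    by rewrite ler_wpM2r// lerDr ltW.
  move=> c c0 ac; have mc := adapted_measurable hF ac.
  have mcE : measurable_fun setT (EFin \o c) by exact/measurable_EFinP.
  have cS0 x : (0 <= (c x)%:E * S x)%E by apply: mule_ge0; rewrite ?lee_fin.
  have cW0 x : (0 <= (c x)%:E * W n x)%E by apply: mule_ge0; rewrite ?lee_fin.
  have mcS : measurable_fun setT (fun x => (c x)%:E * S x)%E by exact: emeasurable_funM.
  have mcW : measurable_fun setT (fun x => (c x)%:E * W n x)%E by exact: emeasurable_funM.
  have hVE : (0 <= h^-1%:E)%E by rewrite lee_fin ltW.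
  (* The chain is E_n H <= E_n S / h <= W_n / h <= eta_n; the middle inequality is proved term by
     term, the outer ones off the null set where D is infinite. *)
  apply: (@le_trans _ _ (h^-1%:E * \int[mu]_x ((c x)%:E * S x))%E).
    rewrite -ge0_integralZl//; apply: ae_ge0_le_integral => //.
    + by move=> x _; rewrite lee_fin mulr_ge0.
    + by apply/measurable_EFinP; mfun.
    + by move=> x _; exact: mule_ge0.
    + exact: measurable_funeM.
    + apply: filterS good => x Dx _; have [Sx _] := goodS x Dx.
      rewrite -[S x]fineK// -!EFinM lee_fin mulrCA ler_wpM2l//; exact: goodH.
  apply: (@le_trans _ _ (h^-1%:E * \int[mu]_x ((c x)%:E * W n x))%E).
    apply: lee_wpmul2l => //.
    under eq_integral do rewrite mul_ser//.
    under [leRHS]eq_integral do rewrite mul_ser//.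
    rewrite (@Int_ser _ _ _ mu (fun k x => c x * uS x k)); last 2 first.
    + by move=> k; mfun.
    + by move=> k x; exact: mulr_ge0.
    rewrite (@Int_ser _ _ _ mu (fun k x => c x * uE n x k)); last 2 first.
    + by move=> k; mfun.
    + by move=> k x; exact: mulr_ge0.
    apply: lee_nneseries => [k _ _|k _]; first by apply: Int_ge0 => x; exact: mulr_ge0.
    rewrite (@eq_Int _ _ _ _ (fun x => c x * uS x k) (fun x => h ^+ k * c x * X k x)); last by move=> x; rewrite /uS; ring.
    rewrite (@eq_Int _ _ _ _ (fun x => c x * uE n x k) (fun x => h ^+ k * c x * E (X k) n x)); last by move=> x; rewrite /uE; ring.
    apply: XE; first by move=> x; rewrite mulr_ge0.
    exact: measurable_funM.
  rewrite -ge0_integralZl//; apply: ae_ge0_le_integral => //.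
  + by move=> x _; exact: mule_ge0.
  + exact: measurable_funeM.
  + by move=> x _; rewrite lee_fin mulr_ge0// le_max (ltW eps0) orbT.
  + apply/measurable_EFinP; apply: measurable_funM => //.
    by apply: measurable_maxr; [apply: measurable_funM; [exact: measurable_cst|exact: mfW]|exact: measurable_cst].
  + apply: filterS good => x Dx _; have [Sx _] := goodS x Dx.
    have [Wx _] := goodW x n nN Sx.
    by rewrite -[W n x]fineK// -!EFinM lee_fin mulrCA ler_wpM2l// /eta le_max lexx.
Qed.

End RubioDeFrancia.

Lemma le_limit_eps {R : realType} (A B : \bar R) (C W : R) : 0 < C -> 0 <= W ->
  (forall e, 0 < e -> (A <= C%:E * (B + (e * W)%:E))%E) -> (A <= C%:E * B)%E.
Proof.
move=> C0 W0 h; apply/lee_addgt0Pr => e e0.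
(* W may be 0, hence W + 1 in the denominator. *)
have e'0 : 0 < e / (C * (W + 1)) by rewrite divr_gt0// mulr_gt0// ltr_wpDl.
apply: (le_trans (h _ e'0)).
have CW : C * (e / (C * (W + 1)) * W) <= e.
  have -> : C * (e / (C * (W + 1)) * W) = e * (W / (W + 1)).
    by field; rewrite !gt_eqF// ltr_wpDl.
  by rewrite ler_piMr ?(ltW e0)// ler_pdivrMr ?ltr_wpDl// mul1r lerDl.
case: B h => [b _|_|_].
- by rewrite -!EFinM -!EFinD lee_fin mulrDr lerD2l.
- by rewrite gt0_muley ?lte_fin// leey.
- by rewrite /= gt0_muleNy ?lte_fin// leNye.
Qed.

(** * Extrapolation *)

Section VectorMaximal.
Context {d : measure_display} {T : measurableType d} {R : realType}.
Variables (mu : {finite_measure set T -> \bar R}) (F : nat -> set (set T)).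
Hypothesis hF : filtration F.

Local Notation I := (Int mu).
Local Notation adapted := (adapted F).
Local Notation cond_le := (cond_le mu F).

Lemma cond_le_trans_le n (u u' v : T -> R) :
  measurable_fun setT u -> measurable_fun setT u' ->
  (forall x, 0 <= u x) -> (forall x, u x <= u' x) -> cond_le n u' v -> cond_le n u v.
Proof.
move=> mu_ mu' u0 uu' h c c0 ac; have mc := adapted_measurable hF ac.
apply: le_trans (h c c0 ac); apply: Int_le; [by mfun|by mfun| |].
- by move=> x; rewrite mulr_ge0.
- by move=> x; rewrite ler_wpM2l.
Qed.

Lemma cond_leM n (b u v : T -> R) : adapted n b -> (forall x, 0 <= b x) ->
  cond_le n u v -> cond_le n (fun x => b x * u x) (fun x => b x * v x).
Proof.
move=> ab b0 h c c0 ac.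
rewrite (@eq_Int _ _ _ _ _ (fun x => c x * b x * u x)); last by move=> x; rewrite mulrA.
rewrite (@eq_Int _ _ _ _ (fun x => c x * (b x * v x)) (fun x => c x * b x * v x)); last by move=> x; rewrite mulrA.
by apply: h; [move=> x; rewrite mulr_ge0|exact: (measurable_funM ac ab)].
Qed.

(** A conditional Hölder inequality. Divided by a^t b^(1-t), the product is at most u/a + v/b, and
    each of these has conditional expectation at most 1; hence the 2. *)
Lemma cond_le_geom n (t : R) (u v a b : T -> R) : 0 <= t <= 1 ->
  measurable_fun setT u -> measurable_fun setT v ->
  (forall x, 0 <= u x) -> (forall x, 0 <= v x) ->
  adapted n a -> adapted n b -> (forall x, 0 < a x) -> (forall x, 0 < b x) ->
  cond_le n u a -> cond_le n v b ->
  cond_le n (fun x => u x `^ t * v x `^ (1 - t)) (fun x => 2 * (a x `^ t * b x `^ (1 - t))).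
Proof.
move=> t01 mu_ mv u0 v0 aa ab a0 b0 ua vb c c0 ac.
have ma := adapted_measurable hF aa; have mb := adapted_measurable hF ab.
have mc := adapted_measurable hF ac.
pose m x := a x `^ t * b x `^ (1 - t).
have m0 x : 0 <= m x by rewrite mulr_ge0 ?powR_ge0.
have am : adapted n m by apply: measurable_funM; exact: measurable_powRf.
have mm : measurable_fun setT m by exact: adapted_measurable am.
pose ca x := c x * m x * a x `^ (-1).
pose cb x := c x * m x * b x `^ (-1).
have ca0 x : 0 <= ca x by apply: mulr_ge0; [apply: mulr_ge0|exact: powR_ge0].
have cb0 x : 0 <= cb x by apply: mulr_ge0; [apply: mulr_ge0|exact: powR_ge0].
have aca : adapted n ca by apply: measurable_funM; [exact: measurable_funM|exact: measurable_powRf].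
have acb : adapted n cb by apply: measurable_funM; [exact: measurable_funM|exact: measurable_powRf].
have mca := adapted_measurable hF aca; have mcb := adapted_measurable hF acb.
apply: (@le_trans _ _ (I (fun x => ca x * u x)%R + I (fun x => cb x * v x)%R)%E).
  rewrite -IntD; [|by mfun|by mfun|by move=> x; rewrite mulr_ge0|by move=> x; rewrite mulr_ge0].
  apply: Int_le; [by mfun|by mfun|by move=> x; rewrite mulr_ge0// mulr_ge0 ?powR_ge0|move=> x].
  have := powR_mean_le (x := u x / a x) (y := v x / b x) (t := t).
  rewrite !divr_ge0 ?(ltW (a0 x)) ?(ltW (b0 x))// => /(_ isT isT t01) h.
  have -> : ca x * u x + cb x * v x = c x * (m x * (u x / a x + v x / b x)).
    by rewrite /ca /cb !powR_inv1 ?(ltW (a0 x)) ?(ltW (b0 x))//; ring.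
  rewrite ler_wpM2l//; apply: le_trans (ler_wpM2l (m0 x) h).
  rewrite !powRM ?invr_ge0 ?(ltW (a0 x)) ?(ltW (b0 x))// /m.
  rewrite -!powR_inv1 ?(ltW (a0 x)) ?(ltW (b0 x))// -!powRrM !mulN1r !powRN.
  have at0 : a x `^ t != 0 by rewrite gt_eqF// powR_gt0.
  have bt0 : b x `^ (1 - t) != 0 by rewrite gt_eqF// powR_gt0.
  by rewrite le_eqVlt; apply/orP; left; apply/eqP; field; rewrite at0 bt0.
apply: (@le_trans _ _ (I (fun x => c x * m x)%R + I (fun x => c x * m x)%R)%E).
  apply: leeD.
    apply: (le_trans (ua _ ca0 aca)); rewrite (@eq_Int _ _ _ _ _ (fun x => c x * m x))// => x.
    by rewrite /ca powR_inv1 ?(ltW (a0 x))// mulfVK// gt_eqF.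
  apply: (le_trans (vb _ cb0 acb)); rewrite (@eq_Int _ _ _ _ _ (fun x => c x * m x))// => x.
  by rewrite /cb powR_inv1 ?(ltW (b0 x))// mulfVK// gt_eqF.
rewrite -IntD; [|by mfun|by mfun|by move=> x; rewrite mulr_ge0|by move=> x; rewrite mulr_ge0].
by rewrite (@eq_Int _ _ _ _ _ (fun x => c x * (2 * m x)))// => x; ring.
Qed.

Section VectorValued.
Variables (N J : nat) (r : R) (f : nat -> T -> R) (e : nat -> nat -> T -> R).

(** Here and in [vmax] the root 1/r is left out, so the p-th powers of the norms become integrals of
    the power p/r. *)
Definition vsum (x : T) : R := \sum_(j < J) f j x `^ r.
Definition vmax (x : T) : R := \sum_(j < J) runmax (fun n => e j n x) N `^ r.

(** Only the upper bound e_(j,n) <= E_n f_j is recorded, since |E_n f_j| <= E_n |f_j| is the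
    relation available for signed functions. *)
Definition maximal_data := [/\ forall j, measurable_fun setT (f j), forall j x, 0 <= f j x,
  forall j n, adapted n (e j n), forall j n x, 0 <= e j n x &
  forall j n, (n < N)%N -> cond_le n (e j n) (f j)].

Hypothesis hfe : maximal_data.

Lemma vsum_ge0 x : 0 <= vsum x.
Proof. by apply: sumr_ge0 => j _; exact: powR_ge0. Qed.

Lemma vmax_ge0 x : 0 <= vmax x.
Proof. by apply: sumr_ge0 => j _; exact: powR_ge0. Qed.

Lemma measurable_maxfun j : measurable_fun setT (fun x => runmax (fun n => e j n x) N).
Proof.
have [_ _ ae _ _] := hfe.
by apply: (measurable_runmax (f := e j)) => n _; exact: adapted_measurable (ae j n).
Qed.

Lemma measurable_vsum : measurable_fun setT vsum.
Proof.
have [mf _ _ _ _] := hfe.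
by apply: measurable_sum => j; apply: measurable_powRf; exact: mf.
Qed.

Lemma measurable_vmax : measurable_fun setT vmax.
Proof. by apply: measurable_sum => j; apply: measurable_powRf; exact: measurable_maxfun. Qed.

End VectorValued.

(** In the exponent r both sides are sums over j of scalar integrals, so the scalar constant serves
    for every J. *)
Lemma weighted_maximal_diag (r K : R) : 1 < r -> 0 < K -> exists2 C : R, 0 < C &
  forall N J (v : T -> R) f e, good_weight mu F r K N v -> maximal_data N f e ->
  (I (fun x => vmax N J r e x * v x)%R <= C%:E * I (fun x => vsum J r f x * v x)%R)%E.
Proof.
move=> r1 K0; have [C C0 hC] := weighted_maximal mu hF r1 K0.
exists C => // N J v f e gv hfe; have [mf f0 ae e0 ef] := hfe.
have [v0 mv _ _ _] := gv.
have mM j := measurable_maxfun hfe j.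
rewrite (@eq_Int _ _ _ _ _ (fun x => \sum_(j < J) runmax (fun n => e j n x) N `^ r * v x)); last first.
  by move=> x; rewrite /vmax big_distrl.
rewrite (@eq_Int _ _ _ _ (fun x => vsum _ _ _ x * v x) (fun x => \sum_(j < J) f j x `^ r * v x)); last first.
  by move=> x; rewrite /vsum big_distrl.
rewrite (@Int_sum _ _ _ mu J (fun j x => runmax (fun n => e j n x) N `^ r * v x)); last 2 first.
- by move=> j; apply: measurable_funM => //; apply: measurable_powRf; exact: mM.
- by move=> j x; rewrite mulr_ge0 ?powR_ge0// ltW.
rewrite (@Int_sum _ _ _ mu J (fun j x => f j x `^ r * v x)); last 2 first.
- by move=> j; mfun.
- by move=> j x; rewrite mulr_ge0 ?powR_ge0// ltW.
rewrite ge0_sume_distrr; last first.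
  by move=> j _; apply: Int_ge0 => x; rewrite mulr_ge0 ?powR_ge0// ltW.
by apply: lee_sum => j _; exact: (hC N v (f j) (e j) gv (mf j) (f0 j) (ae j) (e0 j) (ef j)).
Qed.

End VectorMaximal.

(** * The A_r weights built from an A_p weight and a majorant H *)

Section ExtrapolatedWeights.
Context {d : measure_display} {T : measurableType d} {R : realType}.
Variables (mu : {finite_measure set T -> \bar R}) (F : nat -> set (set T)).
Hypothesis hF : filtration F.

Local Notation I := (Int mu).
Local Notation adapted := (adapted F).
Local Notation cond_le := (cond_le mu F).
Local Notation good_weight := (good_weight mu F).

Lemma ler_powR_npos (a b t : R) : 0 < a -> a <= b -> t <= 0 -> b `^ t <= a `^ t.
Proof.
move=> a0 ab t0; have b0 := lt_le_trans a0 ab.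
rewrite -(opprK t) !(powRN _ (- t)) lef_pV2 ?posrE ?powR_gt0//.
by rewrite ge0_ler_powR ?nnegrE ?oppr_ge0 ?(ltW a0) ?(ltW b0).
Qed.

Lemma Int_lty_le (f g : T -> R) : measurable_fun setT f -> measurable_fun setT g ->
  (forall x, 0 <= f x) -> (forall x, f x <= g x) -> (I g < +oo)%E -> (I f < +oo)%E.
Proof. by move=> mf mg f0 fg; apply: le_lt_trans; exact: Int_le. Qed.

(** With t = (p-1)/(r-1) the dual of w H^(p-r) is s^t H^(1-t), and [cond_le_geom] bounds its
    conditional expectation by 2 b^t eta^(1-t). The power r-1 of this is 2^(r-1) b^(p-1) eta^(r-p),
    and eta <= C H cancels H^(p-r). *)
Lemma good_weight_up (p r K C : R) N (w H : T -> R) (eta : nat -> T -> R) (eps : R) :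
  1 < p -> p <= r -> 0 < C -> good_weight p K N w ->
  measurable_fun setT H -> 0 < eps -> (forall x, eps <= H x) ->
  (I (fun x => H x `^ p * w x)%R < +oo)%E ->
  (forall n, adapted n (eta n)) -> (forall n x, 0 < eta n x) ->
  (forall n, (n < N)%N -> (forall x, eta n x <= C * H x) /\ cond_le n H (eta n)) ->
  good_weight r (2 `^ (r - 1) * C `^ (r - p) * K) N (fun x => w x * H x `^ (p - r)).
Proof.
move=> p1 pr C0 [w0 mw wi si [b [ab b0 sb bw]]] mH eps0 epsH Hi ae e0 he.
have H0 x : 0 < H x := lt_le_trans eps0 (epsH x).
have r1 : 0 < r - 1 by lra.
have p10 : 0 < p - 1 by lra.
have ms : measurable_fun setT (dualw p w) by exact: measurable_powRf.
have s0 x : 0 < dualw p w x by exact: dualw_gt0.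
pose t := (p - 1) / (r - 1).
have t01 : 0 <= t <= 1.
  by rewrite divr_ge0 ?(ltW p10) ?(ltW r1)//= ler_pdivrMr// mul1r; lra.
have dualE x : dualw r (fun x => w x * H x `^ (p - r)) x = dualw p w x `^ t * H x `^ (1 - t).
  rewrite /dualw powRM ?powR_ge0 ?(ltW (w0 x))// -!powRrM; congr (_ `^ _ * _ `^ _).
  - by rewrite /t; field; rewrite !gt_eqF.
  - by rewrite /t; field; rewrite gt_eqF.
have dual0 x : 0 <= dualw p w x `^ t * H x `^ (1 - t) by rewrite mulr_ge0 ?powR_ge0.
have mb n : measurable_fun setT (b n) by exact: adapted_measurable (ab n).
have me n : measurable_fun setT (eta n) by exact: adapted_measurable (ae n).
have dualEf : dualw r (fun x => w x * H x `^ (p - r)) = (fun x => dualw p w x `^ t * H x `^ (1 - t)).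
  by apply/funext => x; exact: dualE.
have mdual : measurable_fun setT (fun x => dualw p w x `^ t * H x `^ (1 - t)) by mfun.
split.
- by move=> x; rewrite mulr_gt0// powR_gt0.
- by mfun.
- apply: (@Int_lty_le _ (fun x => eps `^ (p - r) * w x)); [by mfun|by mfun| | |].
  + by move=> x; rewrite mulr_ge0 ?powR_ge0 ?(ltW (w0 x)).
  + move=> x; rewrite mulrC ler_wpM2r ?(ltW (w0 x))//.
    by apply: ler_powR_npos => //; lra.
  + rewrite IntZ ?powR_ge0//; last by move=> x; exact: ltW.
    by apply: lte_mul_pinfty => //; rewrite lee_fin powR_ge0.
- rewrite dualEf; apply: (@Int_lty_le _ (fun x => dualw p w x + H x)); [by mfun|by mfun|by []| |].
  + by move=> x; apply: powR_mean_le; rewrite ?(ltW (s0 x)) ?(ltW (H0 x)).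
  + rewrite IntD//; [|by move=> x; exact: ltW|by move=> x; exact: ltW].
    apply: lte_add_pinfty => //; apply: (Lp_weight_integrable p1 mw w0 si mH) => // x.
    exact: ltW.
exists (fun n x => 2 * (b n x `^ t * eta n x `^ (1 - t))); split.
- move=> n; apply: measurable_funM; first exact: measurable_cst.
  by apply: measurable_funM; apply: measurable_powRf; [exact: ab|exact: ae].
- by move=> n x; rewrite mulr_gt0// mulr_gt0// powR_gt0.
- move=> n nN; rewrite dualEf; have [_ He] := he n nN.
  by apply: (cond_le_geom hF) => //; [move=> x; exact: ltW|move=> x; exact: ltW|exact: sb].
move=> n nN; have [eH _] := he n nN.
have CK : 0 <= 2 `^ (r - 1) * C `^ (r - p) by rewrite mulr_ge0 ?powR_ge0.
have ac : adapted n (cst (2 `^ (r - 1) * C `^ (r - p))) by exact: measurable_cst.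
have := cond_leM ac (fun=> CK) (bw n nN).
apply: (cond_le_trans_le hF).
- by mfun.
- by rewrite /cst; mfun.
- by move=> x; rewrite mulr_ge0 ?powR_ge0// mulr_ge0 ?powR_ge0 ?(ltW (w0 x)).
move=> x; rewrite /cst.
have b20 : 0 <= b n x `^ t * eta n x `^ (1 - t) by rewrite mulr_ge0 ?powR_ge0.
rewrite [X in X * _]powRM// powRM ?powR_ge0// -!powRrM.
have -> : t * (r - 1) = p - 1 by rewrite /t mulfVK// gt_eqF.
have -> : (1 - t) * (r - 1) = r - p by rewrite /t; field; rewrite gt_eqF.
have hH : eta n x `^ (r - p) * H x `^ (p - r) <= C `^ (r - p).
  have -> : C `^ (r - p) = (C * H x) `^ (r - p) * H x `^ (p - r).
    by rewrite powRM ?(ltW C0) ?(ltW (H0 x))// -mulrA powRDp// (_ : r - p + (p - r) = 0) ?powRr0 ?mulr1//; ring.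
  rewrite ler_wpM2r ?powR_ge0// ge0_ler_powR ?nnegrE ?subr_ge0// ?(ltW (e0 n x))//.
  by rewrite mulr_ge0 ?(ltW C0) ?(ltW (H0 x)).
rewrite [leLHS](_ : _ = 2 `^ (r - 1) * (eta n x `^ (r - p) * H x `^ (p - r)) * (b n x `^ (p - 1) * w x)); last by ring.
by rewrite ler_wpM2r ?mulr_ge0 ?powR_ge0 ?(ltW (w0 x))// ler_wpM2l ?powR_ge0.
Qed.

Lemma dualwK (p : R) (w : T -> R) : 1 < p -> (forall x, 0 < w x) ->
  dualw (p / (p - 1)) (dualw p w) = w.
Proof.
move=> p1 w0; apply/funext => x; rewrite /dualw -powRrM.
rewrite (_ : - _ * - _ = 1) ?powRr1 ?(ltW (w0 x))//.
have p10 : 0 < p - 1 by lra.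
rewrite mulrNN (_ : p / (p - 1) - 1 = (p - 1)^-1); last by field; rewrite gt_eqF.
by rewrite invrK mulVf// gt_eqF.
Qed.

(** The mirror image: the dual weight is s H^(-g) with g = (1-a)/(r-1), whose negative power is
    controlled by eta <= C H, while the geometric mean w^a H^(1-a) is now the weight itself. *)
Lemma good_weight_down (p r K C : R) N (w H : T -> R) (eta : nat -> T -> R) (eps : R) :
  1 < r -> r <= p -> 0 < C -> 0 < K -> good_weight p K N w ->
  measurable_fun setT H -> 0 < eps -> (forall x, eps <= H x) -> (I H < +oo)%E ->
  (forall n, adapted n (eta n)) -> (forall n x, 0 < eta n x) ->
  (forall n, (n < N)%N -> (forall x, eta n x <= C * H x) /\ cond_le n H (eta n)) ->
  good_weight r (2 * C `^ ((p - r) / (p - 1)) * K `^ ((r - 1) / (p - 1))) N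
    (fun x => w x `^ ((r - 1) / (p - 1)) * H x `^ (1 - (r - 1) / (p - 1))).
Proof.
move=> r1 rp C0 K0 [w0 mw wi si [b [ab b0 sb bw]]] mH eps0 epsH Hi ae e0 he.
have H0 x : 0 < H x := lt_le_trans eps0 (epsH x).
have r10 : 0 < r - 1 by lra.
have p10 : 0 < p - 1 by lra.
pose a := (r - 1) / (p - 1); rewrite -/a.
have a01 : 0 <= a <= 1.
  by rewrite divr_ge0 ?(ltW p10) ?(ltW r10)//= ler_pdivrMr// mul1r; lra.
have a1 : 0 <= 1 - a by case/andP: a01 => _; rewrite subr_ge0.
have -> : (p - r) / (p - 1) = 1 - a by rewrite /a; field; rewrite gt_eqF.
pose g := (1 - a) / (r - 1).
have g0 : 0 <= g by rewrite divr_ge0// ltW.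
have ms : measurable_fun setT (dualw p w) by exact: measurable_powRf.
have s0 x : 0 < dualw p w x by exact: dualw_gt0.
have dualEf : dualw r (fun x => w x `^ a * H x `^ (1 - a)) = (fun x => dualw p w x * H x `^ (- g)).
  apply/funext => x; rewrite /dualw powRM ?powR_ge0// -!powRrM; congr (_ `^ _ * _ `^ _).
  - by rewrite /a; field; rewrite !gt_eqF.
  - by rewrite /g; field; rewrite gt_eqF.
have mb n : measurable_fun setT (b n) by exact: adapted_measurable (ab n).
have me n : measurable_fun setT (eta n) by exact: adapted_measurable (ae n).
split.
- by move=> x; rewrite mulr_gt0// powR_gt0.
- by mfun.
- apply: (@Int_lty_le _ (fun x => w x + H x)); [by mfun|by mfun| | |].
  + by move=> x; rewrite mulr_ge0 ?powR_ge0.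
  + by move=> x; apply: powR_mean_le; rewrite ?(ltW (w0 x)) ?(ltW (H0 x)).
  + rewrite IntD//; [|by move=> x; exact: ltW|by move=> x; exact: ltW].
    exact: lte_add_pinfty.
- rewrite dualEf; apply: (@Int_lty_le _ (fun x => eps `^ (- g) * dualw p w x)); [by mfun|by mfun| | |].
  + by move=> x; rewrite mulr_ge0 ?powR_ge0.
  + move=> x; rewrite mulrC ler_wpM2r ?(ltW (s0 x))//.
    by apply: ler_powR_npos => //; rewrite oppr_le0.
  + rewrite IntZ ?powR_ge0//; last by move=> x; exact: ltW.
    by apply: lte_mul_pinfty => //; rewrite lee_fin powR_ge0.
exists (fun n x => C `^ g * eta n x `^ (- g) * b n x); split.
- move=> n; apply: measurable_funM; last exact: ab.
  by apply: measurable_funM; [exact: measurable_cst|apply: measurable_powRf; exact: ae].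
- by move=> n x; rewrite mulr_gt0// mulr_gt0// powR_gt0.
- move=> n nN; rewrite dualEf; have [eH _] := he n nN.
  have ac : adapted n (fun x => C `^ g * eta n x `^ (- g)).
    by apply: measurable_funM; [exact: measurable_cst|apply: measurable_powRf; exact: ae].
  have c0 x : 0 <= C `^ g * eta n x `^ (- g) by rewrite mulr_ge0 ?powR_ge0.
  apply: (cond_le_trans_le hF) (cond_leM ac c0 (sb n nN)).
  + by mfun.
  + by mfun.
  + by move=> x; rewrite mulr_ge0 ?powR_ge0.
  move=> x; rewrite mulrC ler_wpM2r ?(ltW (s0 x))//.
  have -> : C `^ g * eta n x `^ (- g) = (C^-1 * eta n x) `^ (- g).
    rewrite powRM ?invr_ge0 ?(ltW C0) ?(ltW (e0 n x))//; congr (_ * _).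
    by rewrite -powR_inv1 ?(ltW C0)// -powRrM mulN1r opprK.
  apply: ler_powR_npos; rewrite ?oppr_le0//; first by rewrite mulr_gt0// invr_gt0.
  by rewrite ler_pdivrMl.
move=> n nN; have [eH He] := he n nN.
pose c x := C `^ (1 - a) * eta n x `^ (- (1 - a)).
have ac : adapted n c.
  by apply: measurable_funM; [exact: measurable_cst|apply: measurable_powRf; exact: ae].
have c0 x : 0 <= c x by rewrite mulr_ge0 ?powR_ge0.
have bwm : measurable_fun setT (fun x => b n x `^ (p - 1) * w x) by mfun.
have acK : adapted n (cst K) by exact: measurable_cst.
have bw0 x : 0 <= b n x `^ (p - 1) * w x by rewrite mulr_ge0 ?powR_ge0// ltW.
(* Applied to b^(p-1) w, dominated by K, and to H, dominated by eta. The result is 2 K^a eta^(1-a),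
   and [c] cancels the power of eta. Since (p-1) a = r-1, b appears with the exponent needed for
   A_r. *)
have := cond_le_geom hF a01 bwm mH bw0 (fun x => ltW (H0 x)) acK (ae n) (fun=> K0) (e0 n)
  (bw n nN) He.
move=> /(cond_leM ac c0) h.
have -> : cst (2 * C `^ (1 - a) * K `^ a) =
    (fun x => c x * (2 * (cst K x `^ a * eta n x `^ (1 - a)))).
  apply/funext => x; rewrite /cst /c powRN.
  by field; rewrite gt_eqF// powR_gt0.
apply: (cond_le_trans_le hF) h.
- by mfun.
- by rewrite /c; mfun.
- by move=> x; rewrite mulr_ge0 ?powR_ge0// mulr_ge0 ?powR_ge0.
move=> x; rewrite le_eqVlt; apply/orP; left; apply/eqP.
rewrite !powRM ?powR_ge0 ?(ltW (b0 n x)) ?(ltW (w0 x)) ?mulr_ge0 ?powR_ge0// -!powRrM.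
have -> : g * (r - 1) = 1 - a by rewrite /g mulfVK// gt_eqF.
have -> : - g * (r - 1) = - (1 - a) by rewrite mulNr /g mulfVK// gt_eqF.
have -> : (p - 1) * a = r - 1 by rewrite /a mulrC mulfVK// gt_eqF.
by rewrite /c; ring.
Qed.

End ExtrapolatedWeights.

(** * Extrapolation for p <= r *)

Section ExtrapolationUp.
Context {d : measure_display} {T : measurableType d} {R : realType}.
Variables (mu : {finite_measure set T -> \bar R}) (F : nat -> set (set T)).
Hypothesis hF : filtration F.

Local Notation I := (Int mu).
Local Notation adapted := (adapted F).
Local Notation cond_le := (cond_le mu F).
Local Notation good_weight := (good_weight mu F).

Lemma Int_powR_add (p : R) (f g w : T -> R) : 0 <= p ->
  measurable_fun setT f -> measurable_fun setT g -> measurable_fun setT w ->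
  (forall x, 0 <= f x) -> (forall x, 0 <= g x) -> (forall x, 0 <= w x) ->
  (I (fun x => (f x + g x) `^ p * w x)%R <=
   (2 `^ p)%:E * (I (fun x => f x `^ p * w x)%R + I (fun x => g x `^ p * w x)%R))%E.
Proof.
move=> p0 mf mg mw f0 g0 w0.
rewrite -IntD; [|by mfun|by mfun|by pos|by pos].
rewrite -IntZ; [|by mfun|by pos|by pos].
apply: Int_le; [by mfun|by mfun|by pos|move=> x].
by rewrite -mulrDl mulrA ler_wpM2r// powR_add_le.
Qed.

Lemma extrapolation_up (p r K : R) : 1 < p -> p <= r -> 0 < K -> exists2 C : R, 0 < C &
  forall N J w f e, good_weight p K N w -> maximal_data mu F N f e ->
  (I (fun x => vmax N J r e x `^ (p / r) * w x)%R <=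
   C%:E * I (fun x => vsum J r f x `^ (p / r) * w x)%R)%E.
Proof.
move=> p1 pr K0; have p0 : 0 < p by lra.
have r1 : 1 < r by lra.
have r0 : 0 < r by lra.
have [C0 C00 hR] := rubio_de_francia mu hF p1 K0.
have K20 : 0 < 2 `^ (r - 1) * C0 `^ (r - p) * K by rewrite mulr_gt0// mulr_gt0// powR_gt0.
have [C3 C30 hD] := weighted_maximal_diag mu hF r1 K20.
(* C3 + 1 comes from splitting the left-hand integrand into M u and H^p w, C0 from the norm of H,
   and 2^p from separating eps in h. *)
exists ((C3 + 1) * (C0 * 2 `^ p)).
  by rewrite mulr_gt0 ?addr_gt0// mulr_gt0// powR_gt0.
move=> N J w f e gw hfe; have [w0 mw wi si _] := gw.
have [mf f0 ae e0 ef] := hfe.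
have mS := measurable_vsum J r hfe; have mM := measurable_vmax hF J r hfe.
have S0 x := vsum_ge0 J r f x; have M0 x := vmax_ge0 N J r e x.
have hD' v gv := hD N J v f e gv hfe.
move: (vsum J r f) (vmax N J r e) mS mM S0 M0 hD' => S M mS mM S0 M0 hD'.
have w0' x : 0 <= w x by exact: ltW.
have [B BE] : exists B, B = I (fun x => S x `^ (p / r) * w x) := ex_intro _ _ erefl.
rewrite -BE.
have B0 : (0 <= B)%E by rewrite BE; apply: Int_ge0; pos.
have C0' : 0 < (C3 + 1) * (C0 * 2 `^ p).
  by rewrite mulr_gt0 ?addr_gt0// mulr_gt0// powR_gt0.
have [Binf|Bfin] := eqVneq B +oo%E; first by rewrite Binf gt0_muley ?lte_fin// leey.
have [W0 Wfin] : (0 <= I w)%E /\ I w \is a fin_num.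
  have W0 : (0 <= I w)%E by exact: Int_ge0.
  by split => //; rewrite ge0_fin_numE.
apply: (@le_limit_eps _ _ _ _ (fine (I w))) => //; first exact: fine_ge0.
move=> z z0; pose eps := z `^ p^-1.
have eps0 : 0 < eps by exact: powR_gt0.
have epsE : eps `^ p = z by rewrite /eps -powRrM mulVf ?gt_eqF// powRr1// ltW.
pose h x := S x `^ r^-1 + eps.
have mh : measurable_fun setT h by rewrite /h; mfun.
have heps x : eps <= h x by rewrite lerDr powR_ge0.
have hB : (I (fun x => h x `^ p * w x)%R <= (2 `^ p)%:E * (B + (z * fine (I w))%:E))%E.
  have E1 : I (fun x => (S x `^ r^-1) `^ p * w x) = B.
    by rewrite BE; apply: eq_Int => x; rewrite -powRrM (mulrC r^-1).
  have meps : measurable_fun setT (fun _ : T => eps) by exact: measurable_cst.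
  apply: (le_trans (Int_powR_add (ltW p0) (measurable_powRf r^-1 mS) meps mw
    (fun x => powR_ge0 _ _) (fun=> ltW eps0) w0')).
  apply: lee_wpmul2l; first by rewrite lee_fin powR_ge0.
  apply: leeD; first by rewrite E1.
  rewrite IntZ ?powR_ge0//.
  by rewrite epsE EFinM fineK.
have hlty : (I (fun x => h x `^ p * w x)%R < +oo)%E.
  apply: (le_lt_trans hB); apply: lte_mul_pinfty; rewrite ?lee_fin ?powR_ge0//.
  by apply: lte_add_pinfty; rewrite ?ltry// ltey.
have [H [eta [mH hH HB [aeta eta0] hHeta]]] := hR N w h eps gw mh eps0 heps hlty.
have epsH x : eps <= H x by exact: le_trans (heps x) (hH x).
have H0 x : 0 < H x by exact: lt_le_trans eps0 (epsH x).
have Hlty : (I (fun x => H x `^ p * w x)%R < +oo)%E.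
  by apply: (le_lt_trans HB); apply: lte_mul_pinfty => //; rewrite ?lee_fin ?(ltW C00)//; apply: Int_ge0; pos.
have gu := good_weight_up hF p1 pr C00 gw mH eps0 epsH Hlty aeta eta0 hHeta.
have := hD' _ gu.
pose u x := w x * H x `^ (p - r); rewrite -/u => MS.
have u0 x : 0 <= u x by rewrite /u; pos.
have mu_ : measurable_fun setT u by rewrite /u; mfun.
(* S <= H^r because S^(1/r) <= h <= H. *)
have SH x : S x * u x <= H x `^ p * w x.
  rewrite /u mulrCA mulrC ler_wpM2r//.
  have -> : H x `^ p = H x `^ r * H x `^ (p - r) by rewrite powRDp// subrKC.
  rewrite ler_wpM2r ?powR_ge0//.
  have -> : S x = (S x `^ r^-1) `^ r by rewrite -powRrM mulVf ?gt_eqF// powRr1.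
  rewrite ge0_ler_powR ?nnegrE ?powR_ge0 ?(ltW r0) ?(ltW (H0 x))//.
  by apply: le_trans (hH x); rewrite lerDl ltW.
(* M^(p/r) is the geometric mean of M H^(p-r) and H^p with exponents p/r and 1 - p/r: the powers of
   H cancel. *)
have MH x : M x `^ (p / r) * w x <= M x * u x + H x `^ p * w x.
  have t01 : 0 <= p / r <= 1.
    by rewrite divr_ge0 ?(ltW p0) ?(ltW r0)//= ler_pdivrMr// mul1r.
  have := powR_mean_le (mulr_ge0 (M0 x) (powR_ge0 (H x) (p - r))) (powR_ge0 (H x) p) t01.
  rewrite powRM ?powR_ge0// -!powRrM -mulrA powRDp//.
  rewrite (_ : (p - r) * (p / r) + p * (1 - p / r) = 0) ?powRr0 ?mulr1; last first.
    by field; rewrite gt_eqF.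
  move=> h1; apply: (le_trans (ler_wpM2r (w0' x) h1)).
  by rewrite le_eqVlt; apply/orP; left; apply/eqP; rewrite /u; ring.
apply: (@le_trans _ _ (I (fun x => M x * u x)%R + I (fun x => H x `^ p * w x)%R)%E).
  rewrite -IntD; [|by mfun|by mfun|by pos|by pos].
  by apply: Int_le; [mfun|mfun|pos|].
have MSH : (I (fun x => M x * u x)%R <= C3%:E * I (fun x => H x `^ p * w x)%R)%E.
  apply: (le_trans MS); apply: lee_wpmul2l; first by rewrite lee_fin ltW.
  by apply: Int_le; [mfun|mfun|pos|].
apply: (@le_trans _ _ ((C3 + 1)%:E * I (fun x => H x `^ p * w x)%R)%E).
  rewrite EFinD ge0_muleDl ?lee_fin ?(ltW C30)// mul1e.
  by apply: leeD.
rewrite EFinM -muleA; apply: lee_wpmul2l; first by rewrite lee_fin addr_ge0// ltW.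
apply: (le_trans HB); rewrite EFinM -muleA; apply: lee_wpmul2l => //.
by rewrite lee_fin ltW.
Qed.

End ExtrapolationUp.

(** Distributes the right-hand side of the L^r inequality between S^(p/r) w and H^q s with q =
    p/(p-1), in the form required by [powR_mean_eps]. *)
Lemma powR_mean_split {R : realType} (p r s w h : R) : 1 < r -> r < p ->
  0 <= s -> 0 < w -> 0 <= h ->
  (s `^ (p / r) * w) `^ (r / p) * (h `^ (p / (p - 1)) * w `^ (- (p - 1)^-1)) `^ (1 - r / p) =
  s * (w `^ ((r - 1) / (p - 1)) * h `^ (1 - (r - 1) / (p - 1))).
Proof.
move=> r1 rp s0 w0 h0.
have r0 : r != 0 by rewrite gt_eqF// (lt_trans _ r1).
have p0 : p != 0 by rewrite gt_eqF// (lt_trans _ rp)// (lt_trans _ r1).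
have p10 : p - 1 != 0 by rewrite gt_eqF// subr_gt0 (lt_trans r1).
rewrite !powRM ?powR_ge0 ?(ltW w0)// -!powRrM.
have -> : p / r * (r / p) = 1 by field; rewrite p0 r0.
have -> : p / (p - 1) * (1 - r / p) = 1 - (r - 1) / (p - 1) by field; rewrite p0 p10.
have <- : r / p + - (p - 1)^-1 * (1 - r / p) = (r - 1) / (p - 1) by field; rewrite p0 p10.
by rewrite powRr1// -(powRDp _ _ w0); ring.
Qed.

(** Composing the three estimates returns c del c0 P (A + z) on the right, and [del] makes this (A +
    z)/2; as A is finite, half of it is absorbed. *)
Lemma absorb_chain {R : realType} (A B S H : \bar R) (c D del c0 P z : R) :
  0 < c -> 0 < D -> 0 < c0 -> 0 < P -> del = (2 * (c * (c0 * P)))^-1 ->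
  A \is a fin_num -> (0 <= B)%E -> (A <= c%:E * S)%E ->
  (S <= D%:E * B + del%:E * H)%E -> (H <= c0%:E * (P%:E * (A + z%:E)))%E ->
  (A <= (2 * (c * D))%:E * (B + ((2 * (c * D))^-1 * z)%:E))%E.
Proof.
move=> c_gt0 D_gt0 c0_gt0 P_gt0 delE; have del0 : 0 < del by rewrite delE invr_gt0 !mulr_gt0.
case: A => // a _; case: B => [b| |//] B0 AS SH HA; last first.
  by rewrite /= gt0_muley ?leey// lte_fin !mulr_gt0.
have {}SH : (S <= (D * b + del * (c0 * (P * (a + z))))%:E)%E.
  apply: (le_trans SH); rewrite EFinD [(del * _)%:E]EFinM; apply: leeD => //.
  by apply: lee_wpmul2l => //; rewrite lee_fin ltW.
have c0' : (0 <= c%:E)%E by rewrite lee_fin ltW.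
have := le_trans AS (lee_wpmul2l c0' SH).
rewrite -!EFinM !lee_fin.
have -> : c * (D * b + del * (c0 * (P * (a + z)))) = c * D * b + 2^-1 * (a + z).
  by rewrite delE; field; rewrite !gt_eqF.
have -> : 2 * (c * D) * (b + (2 * (c * D))^-1 * z) = 2 * (c * D * b) + z.
  by field; rewrite !gt_eqF.
lra.
Qed.

(** * Extrapolation for r < p *)

Section ExtrapolationDown.
Context {d : measure_display} {T : measurableType d} {R : realType}.
Variables (mu : {finite_measure set T -> \bar R}) (F : nat -> set (set T)).
Hypothesis hF : filtration F.

Local Notation I := (Int mu).
Local Notation adapted := (adapted F).
Local Notation cond_le := (cond_le mu F).
Local Notation good_weight := (good_weight mu F).

(** Purely qualitative: the bound behind it degrades with J, and only finiteness is kept. *)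
Lemma Int_sum_powR_lty (t : R) (J : nat) (a : nat -> T -> R) (w : T -> R) : 0 < t ->
  (forall j, measurable_fun setT (a j)) -> (forall j x, 0 <= a j x) ->
  measurable_fun setT w -> (forall x, 0 <= w x) ->
  (forall j, (j < J)%N -> (I (fun x => a j x `^ t * w x)%R < +oo)%E) ->
  (I (fun x => (\sum_(j < J) a j x) `^ t * w x)%R < +oo)%E.
Proof.
move=> t0 ma a0 mw w0; elim: J => [_|J IH h].
  rewrite (_ : I _ = 0%E) ?ltry// -(integral0 mu setT); apply: eq_integral => x _.
  by rewrite big_ord0 powR0 ?mul0r// gt_eqF.
have mS : measurable_fun setT (fun x => \sum_(j < J) a j x) by exact: measurable_sum.
have S0 x : 0 <= \sum_(j < J) a j x by exact: sumr_ge0.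
rewrite (@eq_Int _ _ _ _ _ (fun x => (\sum_(j < J) a j x + a J x) `^ t * w x)); last first.
  by move=> x; rewrite big_ord_recr.
apply: (le_lt_trans (Int_powR_add mu (ltW t0) mS (ma J) mw S0 (a0 J) w0)).
apply: lte_mul_pinfty; rewrite ?lee_fin ?powR_ge0//.
apply: lte_add_pinfty; last exact: h.
by apply: IH => j jJ; apply: h; exact: ltnW.
Qed.

Lemma extrapolation_down (p r K K' : R) : 1 < r -> r < p -> 0 < K -> 0 < K' ->
  exists2 C : R, 0 < C &
  forall N J w f e, good_weight p K N w -> good_weight (p / (p - 1)) K' N (dualw p w) ->
  maximal_data mu F N f e ->
  (I (fun x => vmax N J r e x `^ (p / r) * w x)%R <=
   C%:E * I (fun x => vsum J r f x `^ (p / r) * w x)%R)%E.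
Proof.
move=> r1 rp K0 K'0; have p1 : 1 < p by lra.
have p0 : 0 < p by lra.
have r0 : 0 < r by lra.
have p10 : 0 < p - 1 by lra.
pose q := p / (p - 1).
have q1 : 1 < q by rewrite ltr_pdivlMr// mul1r; lra.
have q0 : 0 < q by lra.
have [Cs Cs0 hS] := weighted_maximal mu hF p1 K0.
have [C0 C00 hR] := rubio_de_francia mu hF q1 K'0.
pose a := (r - 1) / (p - 1).
have K20 : 0 < 2 * C0 `^ ((p - r) / (p - 1)) * K `^ a.
  by rewrite mulr_gt0 ?powR_gt0// mulr_gt0// powR_gt0.
have [C3 C30 hD] := weighted_maximal_diag mu hF r1 K20.
have rp01 : 0 < r / p <= 1 by rewrite divr_gt0//= ler_pdivrMr// mul1r ltW.
(* Makes C3 del C0 2^q equal to 1/2, for the part of the left-hand side that returns through H. *)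
pose del := (2 * (C3 * (C0 * 2 `^ q)))^-1.
have del0 : 0 < del by rewrite invr_gt0 mulr_gt0// mulr_gt0// mulr_gt0// powR_gt0.
have [D D0 hY] := powR_mean_eps rp01 del0.
have CC0 : 0 < 2 * (C3 * D) by rewrite mulr_gt0// mulr_gt0.
exists (2 * (C3 * D)) => //.
move=> N J w f e gw gs hfe; have [w0 mw wi si _] := gw.
have [mf f0 ae e0 ef] := hfe.
have w0' x : 0 <= w x by exact: ltW.
have ms : measurable_fun setT (dualw p w) by exact: measurable_powRf.
have s0 x : 0 < dualw p w x by exact: dualw_gt0.
have s0' x : 0 <= dualw p w x by exact: ltW.
have mS := measurable_vsum J r hfe; have mM := measurable_vmax hF J r hfe.
have S0 x := vsum_ge0 J r f x; have M0 x := vmax_ge0 N J r e x.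
have rpr t : 0 <= t -> (t `^ r) `^ (p / r) = t `^ p.
  by move=> t0; rewrite -powRrM mulrC mulfVK// gt_eqF.
(* Absorption needs a finite left-hand side; the scalar inequality for each of the J functions
   supplies it. *)
have ABlty : (I (fun x => vsum J r f x `^ (p / r) * w x)%R < +oo)%E ->
    (I (fun x => vmax N J r e x `^ (p / r) * w x)%R < +oo)%E.
  move=> Blty; apply: (@Int_sum_powR_lty _ J (fun j x => runmax (fun n => e j n x) N `^ r)).
  - exact: divr_gt0.
  - by move=> j; apply: measurable_powRf; exact: measurable_maxfun hfe j.
  - by move=> j x; exact: powR_ge0.
  - exact: mw.
  - exact: w0'.
  move=> j jJ.
  rewrite (@eq_Int _ _ _ _ _ (fun x => runmax (fun n => e j n x) N `^ p * w x)); last first.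
    by move=> x; rewrite rpr// runmax_ge0.
  apply: (le_lt_trans (hS N w (f j) (e j) gw (mf j) (f0 j) (ae j) (e0 j) (ef j))).
  apply: lte_mul_pinfty; [by rewrite lee_fin ltW|by []|].
  apply: le_lt_trans Blty; apply: Int_le; [by mfun|by mfun|by pos|move=> x].
  rewrite ler_wpM2r// -rpr// ge0_ler_powR ?nnegrE ?powR_ge0 ?divr_ge0 ?(ltW p0) ?(ltW r0)//.
  rewrite /vsum (bigD1 (Ordinal jJ))//= lerDl; apply: sumr_ge0 => i _; exact: powR_ge0.
have hD' v gv := hD N J v f e gv hfe.
move: (vsum J r f) (vmax N J r e) mS mM S0 M0 hD' ABlty => S M mS mM S0 M0 hD' ABlty.
have [B BE] : exists B, B = I (fun x => S x `^ (p / r) * w x) := ex_intro _ _ erefl.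
have [A AE] : exists A, A = I (fun x => M x `^ (p / r) * w x) := ex_intro _ _ erefl.
rewrite -BE -AE in ABlty *.
have B0 : (0 <= B)%E by rewrite BE; apply: Int_ge0; pos.
have A0 : (0 <= A)%E by rewrite AE; apply: Int_ge0; pos.
have [Binf|Bfin] := eqVneq B +oo%E; first by rewrite Binf gt0_muley ?lte_fin// leey.
have Alty : (A < +oo)%E by apply: ABlty; rewrite ltey.
have Afin : A \is a fin_num by rewrite ge0_fin_numE.
have [W0 Wfin] : (0 <= I (dualw p w))%E /\ I (dualw p w) \is a fin_num.
  have W0 : (0 <= I (dualw p w))%E by exact: Int_ge0.
  by split => //; rewrite ge0_fin_numE.
apply: (@le_limit_eps _ _ _ _ ((2 * (C3 * D))^-1 * fine (I (dualw p w)))) => //.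
  by rewrite mulr_ge0 ?fine_ge0// invr_ge0 ltW.
move=> z z0; pose eps := z `^ q^-1.
have eps0 : 0 < eps by exact: powR_gt0.
have epsE : eps `^ q = z by rewrite /eps -powRrM mulVf ?gt_eqF// powRr1// ltW.
(* M is an r-th power, so this exponent is the p-1 of the maximal function itself; then g^q s is the
   left-hand integrand. *)
pose g x := M x `^ ((p - 1) / r) * w x.
have mg : measurable_fun setT g by rewrite /g; mfun.
have g0 x : 0 <= g x by rewrite /g; pos.
have gE x : g x `^ q * dualw p w x = M x `^ (p / r) * w x.
  rewrite /g powRM ?powR_ge0// -powRrM -mulrA powRDp//.
  rewrite (_ : (p - 1) / r * q = p / r); last by rewrite /q; field; rewrite !gt_eqF.
  rewrite (_ : q + - (p - 1)^-1 = 1) ?powRr1//.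
  by rewrite /q; field; rewrite gt_eqF.
pose h x := g x + eps.
have mh : measurable_fun setT h by rewrite /h; mfun.
have heps x : eps <= h x by rewrite lerDr.
have hB : (I (fun x => h x `^ q * dualw p w x)%R <=
    (2 `^ q)%:E * (A + (z * fine (I (dualw p w)))%:E))%E.
  have E1 : I (fun x => g x `^ q * dualw p w x) = A by rewrite AE; apply: eq_Int.
  have meps : measurable_fun setT (fun _ : T => eps) by exact: measurable_cst.
  apply: (le_trans (Int_powR_add mu (ltW q0) mg meps ms g0 (fun=> ltW eps0) s0')).
  apply: lee_wpmul2l; first by rewrite lee_fin powR_ge0.
  apply: leeD; first by rewrite E1.
  rewrite IntZ ?powR_ge0//.
  by rewrite epsE EFinM fineK.
have hlty : (I (fun x => h x `^ q * dualw p w x)%R < +oo)%E.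
  apply: (le_lt_trans hB); apply: lte_mul_pinfty; rewrite ?lee_fin ?powR_ge0//.
  by apply: lte_add_pinfty; rewrite ?ltry.
have [H [eta [mH hH HB [aeta eta0] hHeta]]] := hR N (dualw p w) h eps gs mh eps0 heps hlty.
have epsH x : eps <= H x by exact: le_trans (heps x) (hH x).
have H0 x : 0 < H x by exact: lt_le_trans eps0 (epsH x).
have H0' x : 0 <= H x by exact: ltW.
have Hlty : (I (fun x => H x `^ q * dualw p w x)%R < +oo)%E.
  by apply: (le_lt_trans HB); apply: lte_mul_pinfty => //; rewrite ?lee_fin ?(ltW C00)//; apply: Int_ge0; pos.
(* The dual of s for the exponent q is w, which is integrable, and H lies in L^q(s). *)
have Hi : (I H < +oo)%E.
  by apply: (Lp_weight_integrable q1 ms s0 _ mH H0' Hlty); rewrite dualwK.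
have gu := good_weight_down hF r1 (ltW rp) C00 K0 gw mH eps0 epsH Hi aeta eta0 hHeta.
have := hD' _ gu; rewrite -/a.
pose u x := w x `^ a * H x `^ (1 - a); rewrite -/u => MS.
have u0 x : 0 <= u x by rewrite /u; pos.
have mu_ : measurable_fun setT u by rewrite /u; mfun.
have aE : (p - 1) * (1 - a) = p - r by rewrite /a; field; rewrite gt_eqF.
have a01 : 0 <= 1 - a by rewrite subr_ge0 ler_pdivrMr// mul1r lerD2r ltW.
(* M^(p/r - 1) w = w^a g^(1-a), and g <= H. *)
have MH x : M x `^ (p / r) * w x <= M x * u x.
  have pr0 : 0 < p / r by exact: divr_gt0.
  rewrite -mulr_powRB1// -mulrA ler_wpM2l//.
  have -> : M x `^ (p / r - 1) * w x = w x `^ a * g x `^ (1 - a).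
    rewrite /g powRM ?powR_ge0// -powRrM mulrCA powRDp// subrKC powRr1//.
    congr (_ `^ _ * _); rewrite mulrAC aE; field; rewrite gt_eqF//.
  rewrite ler_wpM2l ?powR_ge0// ge0_ler_powR ?nnegrE//.
  by apply: le_trans (hH x); rewrite lerDl ltW.
have SH x : S x * u x <= D * (S x `^ (p / r) * w x) + del * (H x `^ q * dualw p w x).
  have := hY (S x `^ (p / r) * w x) (H x `^ q * dualw p w x)
     (mulr_ge0 (powR_ge0 _ _) (w0' x)) (mulr_ge0 (powR_ge0 _ _) (s0' x)).
  by rewrite (powR_mean_split r1 rp (S0 x) (w0 x) (H0' x)).
have step1 : (A <= C3%:E * I (fun x => S x * u x)%R)%E.
  by rewrite AE; apply: le_trans MS; apply: Int_le; [mfun|mfun|pos|].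
have step2 : (I (fun x => S x * u x)%R <=
    D%:E * B + del%:E * I (fun x => H x `^ q * dualw p w x)%R)%E.
  rewrite BE -IntZ; [|by mfun|by pos|by exact: ltW].
  rewrite -IntZ; [|by mfun|by pos|by exact: ltW].
  rewrite -IntD; [|by mfun|by mfun|by pos|by pos].
  by apply: Int_le; [mfun|mfun|pos|].
have C0E : (0 <= C0%:E)%E by rewrite lee_fin ltW.
have step3 := le_trans HB (lee_wpmul2l C0E hB).
rewrite (mulrCA z); apply: (absorb_chain C30 D0 C00 _ erefl Afin B0 step1 step2 step3).
exact: powR_gt0.
Qed.

End ExtrapolationDown.

(** * From the A_p condition to the theorem *)

Section ConditionalExpectation.
Context {d : measure_display} {T : measurableType d} {R : realType}.
Variables (P : probability T R) (F : nat -> set (set T)).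
Hypothesis hF : filtration F.

Local Notation I := (Int P).
Local Notation adapted := (adapted F).
Local Notation cond_le := (cond_le P F).

Lemma adaptedP n (g : T -> R) : measurable_wrt (F n) g <-> adapted n g.
Proof. by have [sF _] := hF; exact: measurable_wrtE. Qed.

(* No integrability of f is needed: on a set where f is not integrable the
   right-hand side is infinite. *)
Lemma cond_exp_abs_le n (f g : T -> R) : measurable_fun setT f ->
  cond_exp P (F n) f g -> cond_le n (fun x => `|g x|) (fun x => `|f x|).
Proof.
move=> mf [/adaptedP ag hg]; have [sF [FT _]] := hF.
have mg := adapted_measurable hF ag.
apply: (cond_leP hF) => //; [exact: measurableT_comp|exact: measurableT_comp|].
move=> A FA; have mA : measurable A by exact: FT FA.
have [fi|nfi] := pselect (P.-integrable A (EFin \o f)); last first.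
  suff -> : (\int[P]_(x in A) `|f x|%:E = +oo)%E by rewrite leey.
  apply/eqP; rewrite -leye_eq leNgt; apply/negP => h; apply: nfi.
  by apply/integrableP; split => //; apply/measurable_EFinP; exact: measurable_funTS.
(* On each of these two F_n-sets g has constant sign, so |g| is g or -g and the equality of
   integrals applies. *)
pose Ap := A `&` [set x | 0 <= g x]; pose An := A `&` ~` [set x | 0 <= g x].
have mG : @measurable _ (g_sigma_algebraType (F n)) [set x | 0 <= g x].
  rewrite -[X in measurable X]setTI.
  have := ag (@measurableT _ _) `[0, +oo[%classic (measurable_itv _).
  by congr measurable; apply/seteqP; split => x /=; rewrite in_itv/= andbT.
have mA' : @measurable _ (g_sigma_algebraType (F n)) A by rewrite measurableG.
have FAp : F n Ap by rewrite -(measurableG (sF n)); exact: measurableI.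
have FAn : F n An by rewrite -(measurableG (sF n)); apply: measurableI => //; exact: measurableC.
have mAp : measurable Ap by exact: FT FAp.
have mAn : measurable An by exact: FT FAn.
have fip : P.-integrable Ap (EFin \o f) by apply: integrableS fi => //; exact: subIsetl.
have fin : P.-integrable An (EFin \o f) by apply: integrableS fi => //; exact: subIsetl.
have [_ Ep] := hg _ FAp fip; have [_ En] := hg _ FAn fin.
have split_ (u : T -> R) : measurable_fun setT u ->
    (\int[P]_(x in A) `|u x|%:E = \int[P]_(x in Ap) `|u x|%:E + \int[P]_(x in An) `|u x|%:E)%E.
  move=> mu_; rewrite -[in LHS](setUIDK A [set x | 0 <= g x]) ge0_integral_setU//.
  - apply/measurable_EFinP/measurable_funTS; exact: measurableT_comp.
  - by rewrite disj_set2E; apply/eqP; rewrite -subset0 => x [[_ h1] [_ h2]].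
rewrite !split_//; apply: leeD.
- rewrite (@eq_integral _ _ _ _ _ (fun x => (g x)%:E)); last first.
    by move=> x /set_mem[_ /= gx]; rewrite ger0_norm.
  rewrite Ep; apply: (le_trans (lee_abs _)).
  by apply: le_abse_integral => //; apply/measurable_EFinP; exact: measurable_funTS.
- have E' : (\int[P]_(x in An) (g x)%:E = - \int[P]_(x in An) `|g x|%:E)%E.
    rewrite -integral_ge0N; last by move=> x _; rewrite lee_fin.
    apply: eq_integral => x /set_mem[_ /= /negP]; rewrite -ltNge => gx.
    by rewrite /= ltr0_norm// opprK.
  rewrite -[leLHS]oppeK -E' En.
  apply: (le_trans (lee_abs _)); rewrite abseN.
  by apply: le_abse_integral => //; apply/measurable_EFinP; exact: measurable_funTS.
Qed.

(** A version of E_n w that is a positive real everywhere, ready to be divided by. As [fine] sends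
    infinity to 0, the test in [al] replaces both exceptional values by 1. *)
Lemma real_cond_exp_weight n (w : T -> R) (a : T -> \bar R) :
  (forall x, 0 < w x) -> measurable_fun setT w -> (I w < +oo)%E ->
  cond_exp_nneg P (F n) w a ->
  exists al : T -> R, [/\ adapted n al, forall x, 0 < al x,
    {ae P, forall x, a x = (al x)%:E} & forall A, F n A ->
     (\int[P]_(x in A) (al x)%:E = \int[P]_(x in A) (w x)%:E)%E].
Proof.
move=> w0 mw wi [ma [a0 aE]]; have [sF [FT _]] := hF.
have ma' : @measurable_fun _ _ (g_sigma_algebraType (F n)) _ setT a.
  by move=> _ B mB; rewrite setTI measurableG//; exact: ma.
have maT : measurable_fun setT a := measurable_sub (sF n) (FT n) ma'.
have FT' : F n setT by rewrite -(measurableG (sF n)).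
pose al x := if fine (a x) == 0 then 1 else fine (a x).
have mfa : @measurable_fun _ _ (g_sigma_algebraType (F n)) _ setT (fine \o a).
  exact: measurableT_comp.
have aal : adapted n al.
  apply: measurable_fun_ifT; [|exact: measurable_cst|exact: mfa].
  by apply: measurable_fun_eqr; [exact: mfa|exact: measurable_cst].
have al0 x : 0 < al x.
  rewrite /al; case: ifPn => // a1.
  by rewrite lt_neqAle eq_sym a1 fine_ge0.
have afin : {ae P, forall x, a x \is a fin_num}.
  have ai : P.-integrable setT a.
    apply/integrableP; split => //; under eq_integral do rewrite gee0_abs//.
    by rewrite aE.
  by have := integrable_ae measurableT ai; apply: filterS => x; apply.
(* On the F_n-set where a = 0 the integral of w vanishes, and w > 0 makes that set null. *)
have apos : {ae P, forall x, a x != 0%E}.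
  pose A := [set x | a x = 0%E].
  have FA : F n A by exact: (ma [set 0%E] (emeasurable_set1 _)).
  have mA : measurable A by exact: FT FA.
  have h : (\int[P]_(x in A) `|(w x)%:E| = 0)%E.
    under eq_integral do rewrite gee0_abs ?lee_fin ?ltW//.
    by rewrite -aE//; apply: integral0_eq => x.
  have mwA : measurable_fun A (EFin \o w) by apply/measurable_EFinP; exact: measurable_funTS.
  have := (ae_eq_integral_abs P mA mwA).1 h.
  apply: filterS => x Ax; apply/eqP => /Ax [] wx.
  by have := w0 x; rewrite wx ltxx.
have aal' : {ae P, forall x, a x = (al x)%:E}.
  apply: filterS2 afin apos => x axf ax0; rewrite /al; case: ifPn => [/eqP h|_].
    by move: ax0; rewrite -(fineK axf) h eqxx.
  by rewrite fineK.
exists al; split => // A FA; rewrite -aE//; apply: ge0_ae_eq_integral.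
- exact: FT FA.
- by apply/measurable_EFinP/measurable_funTS; exact: adapted_measurable aal.
- exact: measurable_funTS.
- by move=> x _; rewrite lee_fin ltW.
- by move=> x _.
- by apply: filterS aal' => x ->.
Qed.

(** The A_p inequality solved for E_n(w^(-1/(p-1))): only E_n w remains as a function, and the
    almost-everywhere bound is hidden in the integrals. *)
Lemma Ap_weight_real (p : R) (w : T -> R) : 1 < p -> weight P w -> Ap_weight P F p w ->
  exists2 K : R, 0 < K & exists al : nat -> T -> R,
  [/\ forall n, adapted n (al n), forall n x, 0 < al n x, forall n, (I (al n) < +oo)%E,
     forall n, cond_le n w (al n) &
     forall n, cond_le n (dualw p w) (fun x => (K * (al n x)^-1) `^ (p - 1)^-1)].
Proof.
move=> p1 [w0 [mw wi]] [K [K0 hK]]; have [sF [FT _]] := hF.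
have p10 : 0 < p - 1 by lra.
have wi' : (I w < +oo)%E.
  by have := integrable_lty measurableT wi.
have mdw : measurable_fun setT (dualw p w) by exact: measurable_powRf.
exists K => //.
have H n : exists al : T -> R, [/\ adapted n al, forall x, 0 < al x, (I al < +oo)%E,
     cond_le n w al & cond_le n (dualw p w) (fun x => (K * (al x)^-1) `^ (p - 1)^-1)].
  have [a [b [ha [hb hab]]]] := hK n.
  have [al [aal al0 aE alE]] := real_cond_exp_weight w0 mw wi' ha.
  have FT' : F n setT by rewrite -(measurableG (sF n)).
  have mal : measurable_fun setT al by exact: adapted_measurable aal.
  exists al; split; [exact: aal|exact: al0| | |].
  - by rewrite /Int alE.
  - apply: (cond_leP hF); [exact: mw|exact: mal|by move=> x; exact: ltW|by move=> x; exact: ltW|].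
    by move=> A FA; rewrite alE.
  have apsi : adapted n (fun x => (K * (al x)^-1) `^ (p - 1)^-1).
    rewrite (_ : (fun x => _) = (fun x => (K * al x `^ (-1)) `^ (p - 1)^-1)).
      apply: measurable_powRf; apply: measurable_funM; first exact: measurable_cst.
      exact: measurable_powRf.
    by apply/funext => x; rewrite powR_inv1// ltW.
  have mpsi := adapted_measurable hF apsi.
  apply: (cond_leP hF);
    [exact: mdw|exact: mpsi|by move=> x; exact: powR_ge0|by move=> x; exact: powR_ge0|].
  move=> A FA; have [mb [b0 bE]] := hb.
  have mb' : measurable_fun setT b.
    apply: (measurable_sub (sF n) (FT n)) => _ B mB.
    by rewrite setTI measurableG//; exact: mb.
  rewrite -(bE A FA); apply: ae_ge0_le_integral.
  - exact: FT FA.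
  - by move=> x _.
  - exact: measurable_funTS.
  - by move=> x _; rewrite lee_fin powR_ge0.
  - by apply/measurable_EFinP; exact: measurable_funTS.
  apply: filterS2 aE hab => x ->.
  (* An infinite value of b would contradict the bound by K, because al > 0. *)
  have := b0 x; case: (b x) => [y y0| _|//]; last first.
    by rewrite poweRyr ?gt_eqF// gt0_muley ?lte_fin// leye_eq.
  rewrite poweR_EFin -EFinM !lee_fin mulrC -ler_pdivlMr// => h _.
  have -> : y = (y `^ (p - 1)) `^ (p - 1)^-1.
    by rewrite -powRrM mulfV ?gt_eqF// powRr1.
  rewrite ge0_ler_powR ?nnegrE ?invr_ge0 ?(ltW p10) ?powR_ge0//.
  by rewrite divr_ge0 ?(ltW K0) ?(ltW (al0 x)).
have [al h] := choice H.
by exists al; split=> n; have [] := h n.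
Qed.

End ConditionalExpectation.

(** * Reduction to a weight with integrable dual *)

Section IntegrableReduction.
Context {d : measure_display} {T : measurableType d} {R : realType}.
Variables (P : probability T R) (F : nat -> set (set T)).
Hypothesis hF : filtration F.

Local Notation I := (Int P).
Local Notation adapted := (adapted F).
Local Notation cond_le := (cond_le P F).

(* m = max(1, K / E_0 w): then E_0(m w) <= E_0 w + K, and
   m^(-1/(p-1)) E_0(w^(-1/(p-1))) <= 1. *)
Lemma Ap_good_weights (p : R) (w : T -> R) : 1 < p -> weight P w -> Ap_weight P F p w ->
  exists (K K' : R) (m : T -> R), [/\ 0 < K, 0 < K', adapted 0 m /\ (forall x, 0 < m x),
    forall N, good_weight P F p K N (fun x => m x * w x) &
    forall N, good_weight P F (p / (p - 1)) K' N (dualw p (fun x => m x * w x))].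
Proof.
move=> p1 hw hA; have [w0 [mw wi]] := hw.
have p10 : 0 < p - 1 by lra.
have Icst (k : R) : 0 <= k -> (I (cst k) < +oo)%E.
  move=> k0; rewrite -[I _]/(\int[P]_x (cst k%:E x))%E integral_cst//.
  by rewrite lte_mul_pinfty ?lee_fin// (le_lt_trans (probability_le1 P measurableT)) ?ltry.
have [K K0 [al [aal al0 ali wal sal]]] := Ap_weight_real hF p1 hw hA.
pose t := (p - 1)^-1; have t0 : 0 < t by rewrite invr_gt0.
have mal n : measurable_fun setT (al n) by exact: adapted_measurable (aal n).
have aalV n : adapted n (fun x => (al n x)^-1).
  rewrite (_ : (fun x => _) = (fun x => al n x `^ (-1))); first exact: (measurable_powRf (-1) (aal n)).
  by apply/funext => x; rewrite powR_inv1// ltW.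
have Ka0 n x : 0 < K * (al n x)^-1 by apply: mulr_gt0; rewrite ?invr_gt0.
have Ka0' n x : 0 <= K * (al n x)^-1 by exact: ltW.
pose psi n x := (K * (al n x)^-1) `^ t.
have psi0 n x : 0 < psi n x by exact: powR_gt0.
have apsi n : adapted n (psi n).
  by apply: measurable_powRf; apply: measurable_funM; [exact: measurable_cst|exact: aalV].
have mpsi n : measurable_fun setT (psi n) by exact: adapted_measurable (apsi n).
have psiE n x : psi n x `^ (p - 1) = K * (al n x)^-1.
  by rewrite /psi -powRrM /t mulVf ?gt_eqF// powRr1.
pose m x := Num.max 1 (K * (al 0%N x)^-1).
have m1 x : 1 <= m x by rewrite le_max lexx.
have m0 x : 0 < m x by exact: lt_le_trans ltr01 (m1 x).
have m0' x : 0 <= m x by exact: ltW.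
have am n : adapted n m.
  apply: (@adapted_le _ _ _ F hF 0) => //; apply: measurable_maxr; first exact: measurable_cst.
  by apply: measurable_funM; [exact: measurable_cst|exact: aalV].
have mm : measurable_fun setT m by exact: adapted_measurable (am 0%N).
pose mt x := m x `^ (- t).
have amt n : adapted n mt := measurable_powRf (- t) (am n).
have mmt : measurable_fun setT mt by exact: adapted_measurable (amt 0%N).
have mt0 x : 0 < mt x by exact: powR_gt0.
have mt0' x : 0 <= mt x by exact: ltW.
pose wt x := m x * w x.
have wt0 x : 0 < wt x by rewrite mulr_gt0.
have mwt : measurable_fun setT wt by rewrite /wt; mfun.
have ms : measurable_fun setT (dualw p w) by exact: measurable_powRf.
have s0 x : 0 < dualw p w x by exact: dualw_gt0.
have dE : dualw p wt = (fun x => mt x * dualw p w x).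
  by apply/funext => x; rewrite /dualw /wt powRM ?ltW.
have mds : measurable_fun setT (dualw p wt) by exact: measurable_powRf.
have wti : (I wt < +oo)%E.
  apply: (le_lt_trans (wal 0%N m m0' (am 0%N))).
  apply: (@le_lt_trans _ _ (I (al 0%N) + I (cst K))%E).
    rewrite -IntD; [|by mfun|exact: measurable_cst|by move=> x; exact: ltW|by move=> x; exact: ltW].
    apply: Int_le; [by mfun|apply: measurable_funD; [by mfun|exact: measurable_cst]
      |by move=> x; rewrite mulr_ge0 ?m0' ?ltW|move=> x].
    rewrite /m; have [_|_] := leP 1 (K * (al 0%N x)^-1).
      by rewrite mulfVK ?gt_eqF// lerDr ltW.
    by rewrite mul1r lerDl ltW.
  apply: lte_add_pinfty; first exact: ali.
  by apply: Icst; exact: ltW.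
have sti : (I (dualw p wt) < +oo)%E.
  rewrite dE; apply: (le_lt_trans (sal 0%N mt mt0' (amt 0%N))).
  apply: (@le_lt_trans _ _ (I (cst 1))); last exact: Icst.
  apply: Int_le; [|exact: measurable_cst| |].
  - by apply: measurable_funM; [exact: mmt|exact: mpsi].
  - by move=> x; rewrite mulr_ge0// powR_ge0.
  - move=> x; rewrite /mt powRN mulrC ler_pdivrMr ?powR_gt0// /cst mul1r.
    rewrite ge0_ler_powR ?nnegrE ?(ltW t0) ?m0'//.
    by rewrite /m le_max lexx orbT.
exists K, (K `^ t), m; split; [exact: K0|exact: powR_gt0|split; [exact: am|exact: m0]| |].
- move=> N; split => //; exists (fun n x => mt x * psi n x); split.
  + by move=> n; apply: measurable_funM; [exact: amt|exact: apsi].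
  + by move=> n x; rewrite mulr_gt0.
  + by move=> n nN; rewrite -/wt dE; exact: (cond_leM (amt n) mt0' (sal n)).
  + move=> n nN c c0 ac.
    pose c' x := c x * (K * (al n x)^-1).
    have c'0 x : 0 <= c' x by apply: mulr_ge0; [exact: c0|exact: Ka0'].
    have ac' : adapted n c' := measurable_funM ac (measurable_funM (@measurable_cst _ _ _ _ _ _) (aalV n)).
    have := wal n c' c'0 ac'.
    rewrite (@eq_Int _ _ _ _ (fun x => c' x * w x) (fun x => c x * ((mt x * psi n x) `^ (p - 1) * (m x * w x)))); last first.
      move=> x; rewrite powRM ?powR_ge0// psiE -powRrM /t mulNr mulVf ?gt_eqF// powR_inv1//.
      by rewrite /c'; field; rewrite !gt_eqF.
    rewrite (@eq_Int _ _ _ _ (fun x => c' x * al n x) (fun x => c x * cst K x))// => x.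
    by rewrite /c' /cst -!mulrA mulVf ?mulr1// gt_eqF.
(* For the dual exponent the roles are exchanged: m al_n dominates E_n(m w), and (m al_n)^t times
   the dual weight equals al_n^t w^(-t), whose conditional expectation is at most K^t. *)
- have qE : p / (p - 1) - 1 = t by rewrite /t; field; rewrite gt_eqF.
  move=> N; rewrite -/wt; split; [by move=> x; exact: dualw_gt0|exact: mds|exact: sti| |].
    by rewrite dualwK.
  exists (fun n x => m x * al n x); split.
  + by move=> n; apply: measurable_funM; [exact: am|exact: aal].
  + by move=> n x; rewrite mulr_gt0.
  + by move=> n nN; rewrite dualwK//; exact: (cond_leM (am n) m0' (wal n)).
  + move=> n nN c c0 ac; rewrite qE.
    pose c' x := c x * al n x `^ t.
    have c'0 x : 0 <= c' x by apply: mulr_ge0; [exact: c0|exact: powR_ge0].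
    have ac' : adapted n c' := measurable_funM ac (measurable_powRf t (aal n)).
    have := sal n c' c'0 ac'.
    rewrite (@eq_Int _ _ _ _ (fun x => c' x * dualw p w x) (fun x => c x * ((m x * al n x) `^ t * dualw p wt x))); last first.
      move=> x; rewrite dE powRM ?m0' ?(ltW (al0 n x))// /mt powRN /c'.
      by field; rewrite gt_eqF// powR_gt0.
    rewrite (@eq_Int _ _ _ _ (fun x => c' x * (K * (al n x)^-1) `^ (p - 1)^-1) (fun x => c x * cst (K `^ t) x))// => x.
    rewrite /c' /cst -/t -mulrA -powRM ?(ltW (al0 n x))//.
    by rewrite mulrCA mulfV ?mulr1// gt_eqF.
Qed.

End IntegrableReduction.

(** * Suprema of real sequences in the extended reals *)

Section Suprema.
Context {R : realType}.
Implicit Types a u : nat -> R.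

Definition esupn u : \bar R := ereal_sup (range (fun n => (u n)%:E)).

Lemma le_esupn u n : ((u n)%:E <= esupn u)%E.
Proof. by apply: ereal_sup_ubound; exists n. Qed.

Lemma esupn_le u B : (forall n, ((u n)%:E <= B)%E) -> (esupn u <= B)%E.
Proof. by move=> uB; apply: ge_ereal_sup => _ [n _ <-]. Qed.

Lemma cvg_esupn u : {homo u : m n / (m <= n)%N >-> m <= n} ->
  (u n)%:E @[n --> \oo] --> esupn u.
Proof. by move=> nd; apply: ereal_nondecreasing_cvgn => m n mn; rewrite lee_fin nd. Qed.

Lemma esupn_ge0 u : (forall n, 0 <= u n) -> (0 <= esupn u)%E.
Proof. by move=> u0; apply: le_trans (le_esupn u 0); rewrite lee_fin. Qed.

Lemma ler_poweR (x y : \bar R) (t : R) : 0 <= t -> (0 <= x)%E -> (x <= y)%E ->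
  (x `^ t <= y `^ t)%E.
Proof.
move=> t0 x0 xy; apply: gt0_ler_poweR => //; rewrite in_itv /= ?leey ?andbT//.
exact: le_trans xy.
Qed.

Lemma esupn_powR u t : 0 < t -> (forall n, 0 <= u n) ->
  esupn (fun n => u n `^ t) = (esupn u `^ t)%E.
Proof.
move=> t0 u0; apply/eqP; rewrite eq_le; apply/andP; split.
  apply: esupn_le => n; rewrite -poweR_EFin; apply: ler_poweR; rewrite ?(ltW t0) ?lee_fin//.
  exact: le_esupn.
set s := esupn (fun n => u n `^ t).
have s0 : (0 <= s)%E by apply: esupn_ge0 => n; exact: powR_ge0.
have us n : ((u n `^ t)%:E <= s)%E by exact: (le_esupn (fun n => u n `^ t)).
move: s s0 us => [y| |//] y0 us; last by rewrite leey.
have -> : y%:E = ((y `^ t^-1)%:E `^ t)%E.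
  by rewrite poweR_EFin -powRrM mulVf ?gt_eqF// powRr1.
apply: ler_poweR; [exact: ltW|exact: esupn_ge0|].
apply: esupn_le => n; rewrite lee_fin -[leLHS]powRr1// -(@mulfV _ t) ?gt_eqF// powRrM.
by rewrite ge0_ler_powR ?nnegrE ?invr_ge0 ?(ltW t0) ?powR_ge0// -lee_fin.
Qed.

Lemma esupn_runmax a : (forall n, 0 <= a n) -> esupn (runmax a) = esupn a.
Proof.
move=> a0; apply/eqP; rewrite eq_le; apply/andP; split.
  apply: esupn_le => N; elim: N => [|N IH] /=; first exact: esupn_ge0.
  by have [_|_] := leP (runmax a N) (a N); [exact: le_esupn|].
apply: esupn_le => n; apply: le_trans (le_esupn (runmax a) n.+1).
by rewrite lee_fin le_runmax.
Qed.

(** Monotonicity in both indices lets the diagonal replace the double limit: for a fixed partial sum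
    of length L, any N >= L dominates it. *)
Lemma esupn_diag_sum (u : nat -> nat -> R) : (forall j N, 0 <= u j N) ->
  (forall j, {homo u j : m n / (m <= n)%N >-> m <= n}) ->
  esupn (fun N => \sum_(j < N) u j N) = (\sum_(0 <= j <oo) esupn (u j))%E.
Proof.
move=> u0 nd; have s0 j : (0 <= esupn (u j))%E by exact: esupn_ge0.
apply/eqP; rewrite eq_le; apply/andP; split.
  apply: esupn_le => N; apply: (@le_trans _ _ (\sum_(0 <= j < N) esupn (u j))%E).
    by rewrite -sumEFin big_mkord; apply: lee_sum => j _; exact: le_esupn.
  by apply: nneseries_lim_ge => j _ _.
apply: lime_le; first by apply: is_cvg_nneseries.
apply: nearW => L.
have cv : (\sum_(0 <= j < L) (u j N)%:E)%E @[N --> \oo] --> (\sum_(0 <= j < L) esupn (u j))%E.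
  apply: cvg_nnesum => [j _|j _]; first by apply: nearW => N; rewrite lee_fin.
  exact: cvg_esupn.
rewrite -(cvg_lim _ cv)//; apply: lime_le; first by apply/cvg_ex; eexists; exact: cv.
exists L => // N /= LN; apply: le_trans (le_esupn _ N).
rewrite sumEFin lee_fin -(big_mkord predT (u^~ N)) (big_cat_nat _ LN)//= lerDl.
exact: sumr_ge0.
Qed.

End Suprema.

(** * The vector inequality for the original weight, and the limit *)

Section FiniteVectorMaximal.
Context {d : measure_display} {T : measurableType d} {R : realType}.
Variables (P : probability T R) (F : nat -> set (set T)).
Hypothesis hF : filtration F.

Local Notation I := (Int P).

Lemma vector_maximal (p r : R) (w : T -> R) : 1 < p -> 1 < r -> weight P w ->
  Ap_weight P F p w -> exists2 C : R, 0 < C & forall N J f e, maximal_data P F N f e ->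
  (I (fun x => vmax N J r e x `^ (p / r) * w x)%R <=
   C%:E * I (fun x => vsum J r f x `^ (p / r) * w x)%R)%E.
Proof.
move=> p1 r1 hw hA; have p0 : 0 < p by lra.
have r0 : 0 < r by lra.
have [K [K' [m [K0 K'0 [am m0] gw gs]]]] := Ap_good_weights hF p1 hw hA.
have [C C0 hC] : exists2 C : R, 0 < C & forall N J f e, maximal_data P F N f e ->
    (I (fun x => vmax N J r e x `^ (p / r) * (m x * w x))%R <=
     C%:E * I (fun x => vsum J r f x `^ (p / r) * (m x * w x))%R)%E.
  have [pr|rp] := leP p r.
    have [C C0 hC] := extrapolation_up P hF p1 pr K0.
    by exists C => // N J f e hfe; exact: hC (gw N) hfe.
  have [C C0 hC] := extrapolation_down P hF r1 rp K0 K'0.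
  by exists C => // N J f e hfe; exact: hC (gw N) (gs N) hfe.
exists C => // N J f e [mf f0 ae e0 ef].
(* Scaling by c commutes with every E_n, c being F_0-measurable, and c^p m = 1 turns the weight m w
   back into w. *)
pose c x := m x `^ (- p^-1).
have c0 x : 0 < c x by exact: powR_gt0.
have c0' x : 0 <= c x by exact: ltW.
have ac n : adapted F n c.
  by apply: (adapted_le hF (leq0n n)); exact: (measurable_powRf (- p^-1) am).
have mc : measurable_fun setT c by exact: adapted_measurable (ac 0%N).
have hfe' : maximal_data P F N (fun j x => c x * f j x) (fun j n x => c x * e j n x).
  split.
  - by move=> j; apply: measurable_funM.
  - by move=> j x; rewrite mulr_ge0.
  - by move=> j n; exact: (measurable_funM (ac n) (ae j n)).
  - by move=> j n x; rewrite mulr_ge0.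
  - by move=> j n nN; exact: (cond_leM (ac n) c0' (ef j n nN)).
have scale u x : 0 <= u -> (c x `^ r * u) `^ (p / r) * (m x * w x) = u `^ (p / r) * w x.
  move=> u0; rewrite powRM ?powR_ge0// /c -!powRrM.
  rewrite (_ : - p^-1 * (r * (p / r)) = -1); last by field; rewrite !gt_eqF.
  by rewrite powR_inv1 ?(ltW (m0 x))//; field; rewrite gt_eqF.
have EM : I (fun x => vmax N J r (fun j n x => c x * e j n x) x `^ (p / r) * (m x * w x)) =
    I (fun x => vmax N J r e x `^ (p / r) * w x).
  apply: eq_Int => x; rewrite -[RHS](scale _ x (vmax_ge0 N J r e x)); congr (_ `^ _ * _).
  rewrite /vmax big_distrr /=; apply: eq_bigr => j _.
  rewrite -powRM ?runmax_ge0//; congr (_ `^ _).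
  rewrite -(@runmax_homo _ (fun n => e j n x) (fun y => c x * y))//; first exact: mulr0.
  by move=> y z /andP[y0 yz]; rewrite ler_wpM2l.
have ES : I (fun x => vsum J r (fun j x => c x * f j x) x `^ (p / r) * (m x * w x)) =
    I (fun x => vsum J r f x `^ (p / r) * w x).
  apply: eq_Int => x; rewrite -[RHS](scale _ x (vsum_ge0 J r f x)); congr (_ `^ _ * _).
  by rewrite /vsum big_distrr /=; apply: eq_bigr => j _; rewrite powRM.
exact: (eq_ind _ (fun z => (z <= _)%E)
  (eq_ind _ (fun z => (_ <= C%:E * z)%E) (hC N J _ _ hfe') _ ES) _ EM).
Qed.

Lemma lr_sum_pow (p r : R) (u : nat -> \bar R) :
  ((((\sum_(0 <= j <oo) (u j `^ r)) `^ r^-1) `^ p) = (\sum_(0 <= j <oo) (u j `^ r)) `^ (p / r))%E.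
Proof. by rewrite -poweRrM mulrC. Qed.

End FiniteVectorMaximal.

Theorem theorem3p11 (d : measure_display) (T : measurableType d) (R : realType)
    (P : probability T R) (F : nat -> set (set T)) (p : R) (w : T -> R) :
  filtration F -> 1 < p -> weight P w -> Ap_weight P F p w ->
  forall r : R, 1 < r ->
  exists C : R, 0 < C /\
    forall (f : nat -> T -> R) (g : nat -> nat -> T -> R),
      (forall j, measurable_fun setT (f j)) ->
      (forall j n, cond_exp P (F n) (f j) (g j n)) ->
      (wLpnorm P w p (lr_sum r (fun j => doob_max (g j)))
       <= C%:E * wLpnorm P w p (lr_sum r (fun j x => (`|f j x|)%:E)))%E.
Proof.
move=> hF p1 hw hA r r1; have p0 : 0 < p by lra.
have r0 : 0 < r by lra.
have pr0 : 0 < p / r by exact: divr_gt0.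
have [C C0 hC] := vector_maximal hF p1 r1 hw hA.
have [w0 [mw _]] := hw.
(* The norms carry the root 1/p. *)
exists (C `^ p^-1); split; first exact: powR_gt0.
move=> f g mf hg.
pose e j n x := `|g j n x|.
pose f' j x := `|f j x|.
have ag j n : adapted F n (g j n) by apply/(adaptedP hF); have [] := hg j n.
have hfe N : maximal_data P F N f' e.
  split.
  - by move=> j; exact: measurableT_comp.
  - by move=> j x; exact: normr_ge0.
  - by move=> j n; apply: measurableT_comp; [exact: normr_measurable|exact: ag].
  - by move=> j n x; exact: normr_ge0.
  - by move=> j n _; exact: (cond_exp_abs_le hF (mf j) (hg j n)).
(* A single index truncates both time and the number of functions, so one monotone limit removes
   both. *)
pose M N x := vmax N N r e x.
have M0 N x : 0 <= M N x by exact: vmax_ge0.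
have mM N : measurable_fun setT (M N) by exact: (measurable_vmax hF N r (hfe N)).
have ndM x : {homo M ^~ x : a b / (a <= b)%N >-> a <= b}.
  move=> a b ab; rewrite /M /vmax.
  rewrite -(big_mkord predT (fun j => runmax (fun n => e j n x) a `^ r)).
  rewrite -(big_mkord predT (fun j => runmax (fun n => e j n x) b `^ r)).
  rewrite (big_cat_nat _ ab)//= ler_wpDr ?sumr_ge0//; first by move=> j _; exact: powR_ge0.
  apply: ler_sum => j _; rewrite ge0_ler_powR ?nnegrE ?runmax_ge0 ?(ltW r0)//.
  exact: runmax_nd.
pose SM x := (\sum_(0 <= j <oo) (doob_max (g j) x `^ r))%E.
pose Sf x := (\sum_(0 <= j <oo) ((`|f j x|)%:E `^ r))%E.
pose Rf := (\int[P]_x (Sf x `^ (p / r) * (w x)%:E))%E.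
have Sf0 x : (0 <= Sf x)%E by apply: nneseries_ge0 => j _ _; exact: poweR_ge0.
have Rf0 : (0 <= Rf)%E.
  by apply: integral_ge0 => x _; rewrite mule_ge0 ?poweR_ge0// lee_fin ltW.
have mSf : measurable_fun setT Sf.
  apply: (ge0_emeasurable_sum (h := fun j x => ((`|f j x|)%:E `^ r)%E)).
    by move=> j x _ _; exact: poweR_ge0.
  move=> j _; apply: (measurableT_comp (measurable_poweR r)).
  by apply/measurable_EFinP; exact: measurableT_comp.
have fRf N : (Int P (fun x => vsum N r f' x `^ (p / r) * w x)%R <= Rf)%E.
  have mv := measurable_vsum N r (hfe N).
  rewrite /Int /Rf; apply: ge0_le_integral.
  - exact: measurableT.
  - by move=> x _; rewrite lee_fin mulr_ge0 ?powR_ge0// ltW.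
  - by apply/measurable_EFinP; mfun.
  - apply: emeasurable_funM; first exact: (measurableT_comp (measurable_poweR (p / r)) mSf).
    exact/measurable_EFinP.
  - move=> x _; rewrite EFinM; apply: lee_wpmul2r; first by rewrite lee_fin ltW.
    rewrite -poweR_EFin; apply: ler_poweR; [exact: ltW|by rewrite lee_fin vsum_ge0|].
    rewrite /vsum -(big_mkord predT (fun j => f' j x `^ r)) -sumEFin /Sf.
    by apply: nneseries_lim_ge => j _ _; rewrite lee_fin; exact: powR_ge0.
have SME x : SM x = esupn (M ^~ x).
  rewrite /M /vmax (esupn_diag_sum (u := fun j N => runmax (e j ^~ x) N `^ r)).
  - apply: eq_eseriesr => j _.
    rewrite (esupn_powR r0); last by move=> n; exact: runmax_ge0.
    by rewrite esupn_runmax// => n; exact: normr_ge0.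
  - by move=> j N; exact: powR_ge0.
  - move=> j a b ab; rewrite ge0_ler_powR ?nnegrE ?runmax_ge0 ?(ltW r0)//.
    exact: runmax_nd.
pose h N x := M N x `^ (p / r) * w x.
have h0 N x : 0 <= h N x by rewrite mulr_ge0 ?powR_ge0// ltW.
have mh N : measurable_fun setT (h N).
  by apply: measurable_funM => //; apply: measurable_powRf; exact: mM.
have ndp x : {homo (fun N => M N x `^ (p / r)) : a b / (a <= b)%N >-> a <= b}.
  by move=> a b ab; rewrite ge0_ler_powR ?nnegrE ?(ltW pr0)//; exact: ndM.
have ndh x : {homo h ^~ x : a b / (a <= b)%N >-> a <= b}.
  by move=> a b ab; rewrite /h ler_wpM2r ?(ltW (w0 x))//; exact: ndp.
have hlim x : (SM x `^ (p / r) * (w x)%:E)%E = limn (fun N => (h N x)%:E).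
  rewrite SME -(esupn_powR pr0)//; apply/esym/cvg_lim => //.
  rewrite /h; under eq_fun do rewrite EFinM.
  by apply: cvgeZr => //; apply: cvg_esupn; exact: ndp.
have main : (\int[P]_x (SM x `^ (p / r) * (w x)%:E) <= C%:E * Rf)%E.
  under eq_integral do rewrite hlim.
  rewrite monotone_convergence//.
  - apply: lime_le.
      by apply: ereal_nondecreasing_is_cvgn => a b ab; apply: Int_le => // x; exact: ndh.
    apply: nearW => N; apply: (le_trans (hC N N f' e (hfe N))).
    by apply: lee_wpmul2l; [rewrite lee_fin ltW|exact: fRf].
  - by move=> N; exact/measurable_EFinP.
  - by move=> N x _; rewrite lee_fin.
  - by move=> x _ a b ab; rewrite lee_fin; exact: ndh.
rewrite /wLpnorm /lr_sum.
under eq_integral do rewrite lr_sum_pow.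
under [in leRHS]eq_integral do rewrite lr_sum_pow.
rewrite -poweR_EFin -poweRM ?lee_fin ?(ltW C0)//.
apply: ler_poweR; [by rewrite invr_ge0 ltW| |exact: main].
by apply: integral_ge0 => x _; rewrite mule_ge0 ?poweR_ge0// lee_fin ltW.
Qed.
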